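(* Let $h>0$, let $B\subset\mathbb Z^8_h$ be bounded and let $f:\partial B\to\mathbb O$. Then: (1) there exists $u:\overline B\to\mathbb O$ with $D^hu(y)=0$ for all $y\in B$ and $u|_{\partial B}=f$ if and only if $P^h_{\partial B}f(y)=f(y)$ for all $y\in\partial B$; (2) there exists $v:\overline{\mathbb Z^8_h\setminus B}\to\mathbb O$ with $D^hv(y)=0$ for all $y\in\mathbb Z^8_h\setminus B$, $|v(y)|\to0$ as $|y|\to\infty$, and $v|_{\partial B}=f$ if and only if $Q^h_{\partial B}f(y)=f(y)$ for all $y\in\partial B$.
   Context: $\mathbb O$ is the real octonion algebra with basis $\mathbf e_0=1,\mathbf e_1,\dots,\mathbf e_7$, where $\mathbf e_i\mathbf e_j=-\delta_{ij}+\sum_k\varepsilon_{ijk}\mathbf e_k$ for $1\le i,j\le 7$, $\varepsilon_{ijk}$ totally antisymmetric with $\varepsilon_{ijk}=1$ for $ijk\in\{123,145,176,246,257,347,365\}$; $\overline{\mathbf e}_0=\mathbf e_0$, $\overline{\mathbf e}_l=-\mathbf e_l$ ($l\ge1$); $|\cdot|$ is the Euclidean norm. For $h>0$, $\mathbb Z^8_h=(h\mathbb Z)^8$, $e_0,\dots,e_7$ are the standard unit vectors of $\mathbb R^8$, $\chi_A$ is the indicator of $A$. $\partial_l^{+,h}f(x)=(f(x+he_l)-f(x))/h$, $\partial_l^{-,h}f(x)=(f(x)-f(x-he_l))/h$, $\partial_l^h=\frac12(\partial_l^{+,h}+\partial_l^{-,h})$, $D^hf=\sum_l\mathbf e_l\partial_l^hf$.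 $N(x)=\{x,x\pm he_0,\dots,x\pm he_7\}$; for $A\subset\mathbb Z^8_h$: $\partial A=\{x:\ N(x)\cap A\neq\emptyset,\ N(x)\cap(\mathbb Z^8_h\setminus A)\neq\emptyset\}$, $\overline A=A\cup\partial A$ (note $\partial(\mathbb Z^8_h\setminus B)=\partial B$). For $x\in\partial B$: $\Sigma(x)=\sum_l[(\partial_l^{+,h}\chi_B(x))^2+(\partial_l^{-,h}\chi_B(x))^2]$, $s(x)=\frac{h^8}{2}\sqrt{\Sigma(x)}$, $n_l^\pm(x)=-2\partial_l^{\pm,h}\chi_B(x)/\sqrt{\Sigma(x)}$, $\int_{\partial B}g\,dS=\sum_{x\in\partial B}g(x)s(x)$. Fundamental solution: $E^1(x)=\frac{1}{(2\pi)^8}\int_{[-\pi,\pi]^8}\frac{\sum_l\overline{\mathbf e}_l\sin u_l}{\sum_l\sin^2u_l}\sin(\sum_lu_lx_l)\,du$ ($x\in\mathbb Z^8$), $E^h(x)=h^{-7}E^1(x/h)$. Star product: $K^h(x,y)*g(x)=-\frac12\sum_{l=0}^7\big(E^h(he_l-x+y)n_l^-(x)+E^h(-he_l-x+y)n_l^+(x)\big)(\mathbf e_lg(x))$. For $g:\partial B\to\mathbb O$: $S^h_{\partial B}g(y)=2\int_{\partial B}K^h(x,y)*\big(g(x)-g(y)\big)dS(x)+g(y)$ ($y\in\partial B$), $P^h_{\partial B}g=\frac12(g+S^h_{\partial B}g)$, $Q^h_{\partial B}g=\frac12(g-S^h_{\partial B}g)$. *)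

(* Defs.v *)
From HB Require Import structures.
From mathcomp Require Import all_boot all_order all_algebra.
From mathcomp Require Import all_classical all_reals all_analysis.
Set Implicit Arguments. Unset Strict Implicit. Unset Printing Implicit Defensive.
Import Order.TTheory GRing.Theory Num.Theory.
Local Open Scope classical_set_scope.
Local Open Scope ring_scope.

(* Points of Z^8_h are represented by their integer coordinate vectors k,
   the actual point being h*k. *)
Definition pt := 'rV[int]_8.
Definition ept (l : 'I_8) : pt := \row_(i < 8) ((i == l)%:R : int).

Definition oct (R : realType) := 'rV[R]_8.

Section Oct.
Variable R : realType.

Definition obas (l : 'I_8) : oct R := \row_(i < 8) ((i == l)%:R : R).

Definition pos_triples : seq (nat * nat * nat) :=
  [:: (1,2,3); (1,4,5); (1,7,6); (2,4,6); (2,5,7); (3,4,7); (3,6,5)]%N.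

(* totally antisymmetric epsilon with eps_ijk = 1 on pos_triples *)
Definition epsi (i j k : nat) : R :=
  if has (fun t => let: (a,b,c) := t in
            [|| ((a,b,c) == (i,j,k)), ((b,c,a) == (i,j,k)) | ((c,a,b) == (i,j,k))])
         pos_triples then 1
  else if has (fun t => let: (a,b,c) := t in
            [|| ((b,a,c) == (i,j,k)), ((a,c,b) == (i,j,k)) | ((c,b,a) == (i,j,k))])
         pos_triples then -1
  else 0.

Definition mcoef (i j k : 'I_8) : R :=
  if val i == 0%N then ((j == k)%:R)
  else if val j == 0%N then ((i == k)%:R)
  else - ((i == j) && (val k == 0%N))%:R + epsi i j k.

Definition omul (a b : oct R) : oct R :=
  \row_(k < 8) \sum_(i < 8) \sum_(j < 8) a ord0 i * b ord0 j * mcoef i j k.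

Definition onorm (a : oct R) : R := Num.sqrt (\sum_(i < 8) a ord0 i ^+ 2).

Definition ptnorm (h : R) (k : pt) : R :=
  Num.sqrt (\sum_(i < 8) (h * (k ord0 i)%:~R) ^+ 2).

Definition nbhd (x : pt) : set pt :=
  [set y | y = x \/ exists l, y = x + ept l \/ y = x - ept l].
Definition bdry (A : set pt) : set pt :=
  [set x | (exists y, nbhd x y /\ A y) /\ (exists y, nbhd x y /\ ~ A y)].
Definition clos (A : set pt) : set pt := A `|` bdry A.

(* difference operators (in lattice coordinates: x + h e_l <-> k + ept l) *)
Definition dplus (h : R) (l : 'I_8) (f : pt -> oct R) (x : pt) : oct R :=
  h^-1 *: (f (x + ept l) - f x).
Definition dminus (h : R) (l : 'I_8) (f : pt -> oct R) (x : pt) : oct R :=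
  h^-1 *: (f x - f (x - ept l)).
Definition dcent (h : R) (l : 'I_8) (f : pt -> oct R) (x : pt) : oct R :=
  2^-1 *: (dplus h l f x + dminus h l f x).
Definition Dh (h : R) (f : pt -> oct R) (x : pt) : oct R :=
  \sum_(l < 8) omul (obas l) (dcent h l f x).

Definition chi (B : set pt) (x : pt) : R := (\1_B x : R).
Definition dpchi (h : R) (B : set pt) (l : 'I_8) (x : pt) : R :=
  (chi B (x + ept l) - chi B x) / h.
Definition dmchi (h : R) (B : set pt) (l : 'I_8) (x : pt) : R :=
  (chi B x - chi B (x - ept l)) / h.
Definition Sig (h : R) (B : set pt) (x : pt) : R :=
  \sum_(l < 8) (dpchi h B l x ^+ 2 + dmchi h B l x ^+ 2).
Definition sdS (h : R) (B : set pt) (x : pt) : R :=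
  h ^+ 8 / 2 * Num.sqrt (Sig h B x).
Definition nplus (h : R) (B : set pt) (l : 'I_8) (x : pt) : R :=
  - 2 * dpchi h B l x / Num.sqrt (Sig h B x).
Definition nminus (h : R) (B : set pt) (l : 'I_8) (x : pt) : R :=
  - 2 * dmchi h B l x / Num.sqrt (Sig h B x).

Fixpoint iint (n : nat) (F : (nat -> R) -> R) : R :=
  match n with
  | 0%N => F (fun _ => 0)
  | n'.+1 => Rintegral (@lebesgue_measure R) `[(- pi)%R, pi]%classic
               (fun t => iint n' (fun u => F (fun i => if i == n' then t else u i)))
  end.

(* fundamental solution E^1 on Z^8, component l; conj(e_0)=e_0, conj(e_l)=-e_l *)
Definition E1 (x : pt) : oct R :=
  \row_(l < 8) ((if val l == 0%N then 1 else -1) * (2 * pi) ^- 8 *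
     iint 8 (fun u => sin (u l) / (\sum_(m < 8) sin (u m) ^+ 2)
                      * sin (\sum_(m < 8) u m * (x ord0 m)%:~R))).

Definition Eh (h : R) (x : pt) : oct R := h ^- 7 *: E1 x.

(* star product K^h(x,y) * w, for the constant value w *)
Definition star (h : R) (B : set pt) (x y : pt) (w : oct R) : oct R :=
  - 2^-1 *: \sum_(l < 8)
     omul (nminus h B l x *: Eh h (ept l - x + y) + nplus h B l x *: Eh h (- ept l - x + y))
          (omul (obas l) w).

Definition Sop (h : R) (B : set pt) (g : pt -> oct R) (y : pt) : oct R :=
  2 *: (\sum_(x \in bdry B) (sdS h B x *: star h B x y (g x - g y))) + g y.
Definition Pop (h : R) (B : set pt) (g : pt -> oct R) (y : pt) : oct R :=
  2^-1 *: (g y + Sop h B g y).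
Definition Qop (h : R) (B : set pt) (g : pt -> oct R) (y : pt) : oct R :=
  2^-1 *: (g y - Sop h B g y).

End Oct.

(* Main.v *)
(** For g on the lattice put W g (y) = sum over x in B of E(y - x) (D g (x)).
    The components of E are derivatives of one scalar kernel, so the matrix of
    their central differences is symmetric; polarised alternativity then makes E
    a two-sided fundamental solution despite non-associativity. Summation by
    parts turns the boundary integral into Q g = W g and P g = g - W g, and
    D (W g) = chi_B D g. Hence u = f - W f solves (1) and v = W f solves (2).
    Conversely Q g only sees g on the boundary: in (1) this gives W f = W u = 0
    there, and in (2), v - W v is monogenic on the whole lattice and tends to 0,
    so it vanishes because conj(D) D is a sum of second differences, which obeys
    the maximum principle.

    That E tends to 0 is Bessel's inequality: its components are Fourier
    coefficients of sin u_m / sum_l sin^2 u_l, whose square is at most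
    1 / sum_l sin^2 u_l, and this is integrable since AM-GM bounds it by the
    product of the integrable functions |sin u_i|^(-1/2). *)
Require Import Defs.
From HB Require Import structures.
From mathcomp Require Import all_boot all_order all_algebra.
From mathcomp Require Import all_classical all_reals all_analysis.
From mathcomp Require Import measurable_realfun.
From mathcomp Require Import finmap zify ring lra.
Import Order.TTheory GRing.Theory Num.Theory.
Import numFieldNormedType.Exports.
Local Open Scope classical_set_scope.
Local Open Scope ring_scope.
Set Implicit Arguments.
Unset Strict Implicit.
Unset Printing Implicit Defensive.

(** * Integrability of |sin|^(-1/2) *)

(** The kernel is defined by eight nested one-variable integrals of a function that is singular
    where all the sines vanish. The nesting is handled one layer at a time: functions that are
    sequentially continuous where no sine vanishes and dominated by a product of one-variable
    weights form a class stable under integrating out a coordinate, so linearity and positivity pass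
    through each layer in turn. The exponent -1/2 of the weight comes from spreading the degree -2
    of the reciprocal of sum_l sin^2 u_l over four coordinates. Decay of E enters only as finiteness
    of the sets where a component exceeds a given positive constant; this is what Bessel's
    inequality yields and what the maximum principle uses. *)

Section primitive.
Variable R : realType.
Notation mu := (@lebesgue_measure R).

(** The [n.+3] keeps the part removed at each end below half the length, so that every interval is
    nondegenerate. *)
Let shrink (a b : R) (n : nat) : set R :=
  `[a + (b - a) / n.+3%:R, b - (b - a) / n.+3%:R].

Let shrink_nd (a b : R) : a < b -> nondecreasing_seq (shrink a b).
Proof.
move=> ab m n mn; rewrite subsetEset => x; rewrite /shrink /= !in_itv /=.
have : (b - a) / n.+3%:R <= (b - a) / m.+3%:R.
  by rewrite ler_pM2l ?subr_gt0// lef_pV2 ?posrE// ler_nat.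
move: (_ / n.+3%:R) (_ / m.+3%:R) => p q.
by move=> h /andP[h1 h2]; apply/andP; split; lra.
Qed.

Let shrink_sub (a b : R) n : a < b -> shrink a b n `<=` `]a, b[.
Proof.
move=> ab x; rewrite /shrink /= !in_itv /=.
have : 0 < (b - a) / n.+3%:R by rewrite divr_gt0 ?subr_gt0.
by move: (_ / n.+3%:R) => p h /andP[h1 h2]; apply/andP; split; lra.
Qed.

Let shrink_lt (a b : R) n : a < b ->
  a + (b - a) / n.+3%:R < b - (b - a) / n.+3%:R.
Proof.
move=> ab; have ba : 0 < b - a by rewrite subr_gt0.
suff: (b - a) / n.+3%:R < (b - a) / 2 by move: (_ / n.+3%:R) => p; lra.
by rewrite ltr_pM2l// ltf_pV2 ?posrE// ltr_nat.
Qed.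

Let bigcup_shrink (a b : R) : a < b -> \bigcup_n shrink a b n = `]a, b[%classic.
Proof.
move=> ab; apply/seteqP; split=> [x [n _]|x]; first exact: shrink_sub.
rewrite /= in_itv /= => /andP[ax xb].
have ba : 0 < b - a by rewrite subr_gt0.
pose e := Num.min (x - a) (b - x).
have e0 : 0 < e by rewrite lt_min !subr_gt0 ax xb.
exists (Num.truncn ((b - a) / e)) => //.
have h : (b - a) / (Num.truncn ((b - a) / e)).+3%:R <= e.
  rewrite ler_pdivrMr// [e * _]mulrC -ler_pdivrMr//.
  apply: le_trans (ltW (truncnS_gt _)) _.
  by rewrite ler_nat ltnS -addn2 leq_addr.
have : e <= x - a by rewrite ge_min lexx.
have : e <= b - x by rewrite ge_min lexx orbT.
rewrite /shrink /= in_itv /=; move: (_ / _.+3%:R) h => p h h1 h2.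
by apply/andP; split; lra.
Qed.

(** The fundamental theorem bounds the integral over each compact [shrink] by the values of [F] at
    its ends, hence by 2M. Monotone convergence then reaches the open interval, at whose ends [f]
    may blow up. *)
Lemma integrable_bounded_primitive (a b M : R) (f F : R -> R) : a < b ->
  (forall x, x \in `]a, b[ -> {for x, continuous f}) ->
  (forall x, x \in `]a, b[ -> 0 <= f x) ->
  (forall x, x \in `]a, b[ -> is_derive x 1 F (f x)) ->
  (forall x, x \in `]a, b[ -> `|F x| <= M) ->
  mu.-integrable `]a, b[ (EFin \o f).
Proof.
move=> ab cf f0 dF FM.
have mf : measurable_fun `]a, b[ f.
  by apply: open_continuous_measurable_fun => // x; rewrite in_setE; exact: cf.
have msh n : measurable (shrink a b n) by exact: measurable_itv.
apply/integrableP; split; first exact/measurable_EFinP.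
have -> : (\int[mu]_(x in `]a, b[) `|(EFin \o f) x| =
    \int[mu]_(x in `]a, b[) (EFin \o f) x)%E.
  apply: eq_integral => x; rewrite in_setE => xab.
  by rewrite /= ger0_norm ?f0.
have cvi : (\int[mu]_(x in shrink a b i) (EFin \o f) x)%E @[i --> \oo] -->
    (\int[mu]_(x in \bigcup_i shrink a b i) (EFin \o f) x)%E.
  apply: ge0_nondecreasing_set_cvg_integral => //.
  - exact: shrink_nd.
  - move=> i; apply/measurable_EFinP; apply: measurable_funS mf => //.
    exact: shrink_sub.
  - by move=> i x /(shrink_sub ab) xab; rewrite lee_fin f0.
rewrite bigcup_shrink // in cvi.
apply: (@le_lt_trans _ _ (M + M)%:E); last exact: ltry.
move/cvg_lim : (cvi) => <- //.
apply: lime_le; first by apply/cvg_ex; eexists; exact: cvi.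
apply: nearW => n.
have cont_in x : x \in shrink a b n -> x \in `]a, b[.
  by rewrite in_setE => /(shrink_sub ab).
have sF x : x \in shrink a b n -> {for x, continuous F}.
  move=> /cont_in /dF dFx.
  by apply: differentiable_continuous; apply/derivable1_diffP.
rewrite /shrink (@continuous_FTC2 _ f F); first last.
- move=> x xi; rewrite derive1E; apply: derive_val.
  by apply: dF; apply: cont_in; rewrite in_setE; apply: subset_itv_oo_cc.
- have cF : {within shrink a b n, continuous F}.
    by apply: continuous_in_subspaceT => x; exact: sF.
  move: cF; rewrite /shrink => /continuous_within_itvP [].
    exact: shrink_lt.
  move=> _ c1 c2; split => //.
  move=> x xi.
  have : is_derive x 1 F (f x).
    by apply: dF; apply: cont_in; rewrite in_setE; apply: subset_itv_oo_cc.
  by case.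
- apply: continuous_in_subspaceT => x xs; apply: cf.
  exact: cont_in.
- exact: shrink_lt.
rewrite -EFinB lee_fin.
have := shrink_lt n ab; rewrite /shrink => hlt.
have m1 : `|F (b - (b - a) / n.+3%:R)| <= M.
  by apply: FM; apply: cont_in; rewrite in_setE /shrink /= in_itv /= lexx ltW.
have m2 : `|F (a + (b - a) / n.+3%:R)| <= M.
  by apply: FM; apply: cont_in; rewrite in_setE /shrink /= in_itv /= lexx ltW.
move: m1 m2; rewrite !ler_norml => /andP[_ m1] /andP[m2 _].
lra.
Qed.

End primitive.

(** * The one-variable weight and its integrability *)

Section weight.
Variable R : realType.
Notation mu := (@lebesgue_measure R).

(** The points of [-pi, pi] at which the sine does not vanish. *)
Definition regular : set R := `]- pi, 0[ `|` `]0, pi[.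

Definition weight (t : R) : R := (Num.sqrt `|sin t|)^-1.

Lemma regular_sin_neq0 t : regular t -> sin t != 0.
Proof.
case; rewrite /= in_itv /= => /andP[h1 h2]; last by rewrite gt_eqF// sin_gt0_pi ?h1.
by rewrite -oppr_eq0 -sinN gt_eqF// sin_gt0_pi// oppr_gt0 h2 ltrNl.
Qed.

(** Lets a bound by some of the weights be enlarged to a bound by all of them. *)
Lemma weight_ge1 t : regular t -> 1 <= weight t.
Proof.
move=> /regular_sin_neq0 st.
rewrite /weight invf_ge1 ?sqrtr_gt0 ?normr_gt0//.
by rewrite -[leRHS]sqrtr1 ler_sqrt// ler_norml sin_geN1 sin_le1.
Qed.

Lemma weight_continuous t : sin t != 0 -> {for t, continuous weight}.
Proof.
move=> st; apply: cvgV.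
  by rewrite gt_eqF// sqrtr_gt0 normr_gt0.
apply: (@continuous_comp _ _ _ (fun t => `|sin t|)); last exact: sqrt_continuous.
apply: (@continuous_comp _ _ _ sin); first exact: continuous_sin.
exact: norm_continuous.
Qed.

Lemma regular_measurable : measurable regular.
Proof. by apply: measurableU; exact: measurable_itv. Qed.

Lemma regular_open : open regular.
Proof. by apply: openU; exact: interval_open. Qed.

(* On an interval where [e * sin > 0], with p, q the fourth roots of
   [1 - cos] and [1 + cos], the derivative of [e * (p - q)] is
   [(q^2 / p + p^2 / q) / 4], which dominates [weight / 4 = 1 / (4 p q)]
   because p^4 + q^4 = 2 forces p^3 + q^3 >= 1. *)
Let integrable_weight_itv (a b e : R) : a < b -> e ^+ 2 = 1 ->
  (forall x, x \in `]a, b[ -> 0 < e * sin x) ->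
  mu.-integrable `]a, b[ (EFin \o weight).
Proof.
move=> ab e2 esin.
pose A (x : R) := 1 - cos x; pose B (x : R) := 1 + cos x.
have ABs x : A x * B x = sin x ^+ 2 by rewrite sin2cos2 /A /B; ring.
have AB2 x : A x + B x = 2 by rewrite /A /B; ring.
have A_ge0 x : 0 <= A x by rewrite subr_ge0 cos_le1.
have B_ge0 x : 0 <= B x by rewrite -lerBlDl sub0r cos_geN1.
have AB_gt0 x : x \in `]a, b[ -> 0 < A x /\ 0 < B x.
  move=> /esin; rewrite !lt0r A_ge0 B_ge0 !andbT.
  case/andP => /negP; rewrite mulf_eq0 -(sqrf_eq0 (sin x)) -ABs mulf_eq0 => h _.
  by split; apply: contra_notN h => ->; rewrite ?orbT.
pose F x := e * (Num.sqrt (Num.sqrt (A x)) - Num.sqrt (Num.sqrt (B x))).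
(* [r4 f x] is the factor of f'(x) in the derivative of the fourth root of f. *)
pose r4 (f : R -> R) x := (2 * Num.sqrt (Num.sqrt (f x)))^-1 * (2 * Num.sqrt (f x))^-1.
pose f x := e * (r4 A x * sin x + r4 B x * sin x).
have sq4 (x : R) : 0 <= x -> Num.sqrt (Num.sqrt x) ^+ 4 = x.
  by move=> x0; rewrite (exprM _ 2 2) !sqr_sqrtr ?sqrtr_ge0.
have cr (g : R -> R) x : {for x, continuous g} -> 0 < g x ->
    {for x, continuous (r4 g)}.
  move=> cg g0.
  have c1 : {for x, continuous (fun y => Num.sqrt (g y))}.
    by apply: (@continuous_comp _ _ _ g) => //; exact: sqrt_continuous.
  have c2 : {for x, continuous (fun y => Num.sqrt (Num.sqrt (g y)))}.
    apply: (@continuous_comp _ _ _ (fun y => Num.sqrt (g y))) => //.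
    exact: sqrt_continuous.
  apply: cvgM; apply: cvgV.
  - by rewrite mulf_neq0// gt_eqF// !sqrtr_gt0.
  - by apply: cvgM => //; exact: cvg_cst.
  - by rewrite mulf_neq0// gt_eqF// !sqrtr_gt0.
  - by apply: cvgM => //; exact: cvg_cst.
have wf x : x \in `]a, b[ -> 0 <= f x /\ weight x <= 4 * f x.
  move=> xab; have [A0 B0] := AB_gt0 _ xab.
  pose p := Num.sqrt (Num.sqrt (A x)); pose q := Num.sqrt (Num.sqrt (B x)).
  have p0 : 0 < p by rewrite !sqrtr_gt0.
  have q0 : 0 < q by rewrite !sqrtr_gt0.
  have p0' := ltW p0; have q0' := ltW q0.
  have Ap : Num.sqrt (A x) = p ^+ 2 by rewrite sqr_sqrtr ?sqrtr_ge0.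
  have Bq : Num.sqrt (B x) = q ^+ 2 by rewrite sqr_sqrtr ?sqrtr_ge0.
  have es : e * sin x = p ^+ 2 * q ^+ 2.
    have : e * sin x = Num.sqrt ((e * sin x) ^+ 2).
      by rewrite sqrtr_sqr gtr0_norm ?esin.
    by rewrite exprMn e2 mul1r -ABs sqrtrM ?A_ge0// Ap Bq.
  have ns : `|sin x| = e * sin x.
    rewrite -(gtr0_norm (esin _ xab)) normrM.
    by rewrite (_ : `|e| = 1) ?mul1r// -sqrtr_sqr e2 sqrtr1.
  have fE : f x = (q ^+ 2 / p + p ^+ 2 / q) / 4.
    rewrite /f /r4 -/p -/q Ap Bq -mulrDl mulrCA es.
    by field; rewrite !gt_eqF.
  split.
    by rewrite fE divr_ge0// addr_ge0// divr_ge0// exprn_ge0.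
  rewrite /weight ns es sqrtrM ?exprn_ge0// !sqrtr_sqr !gtr0_norm//.
  rewrite fE mulrCA divff// mulr1.
  have -> : q ^+ 2 / p + p ^+ 2 / q = (p ^+ 3 + q ^+ 3) * (p * q)^-1.
    by field; rewrite !gt_eqF.
  rewrite ler_peMl// ?invr_ge0 ?mulr_ge0//.
  have pq : p ^+ 4 + q ^+ 4 = 2 by rewrite !sq4// AB2.
  have [p1|p1] := leP 1 p.
    by rewrite -[1]addr0 lerD// ?exprn_ege1// exprn_ge0.
  rewrite -[1]add0r lerD// ?exprn_ge0// exprn_ege1//.
  rewrite leNgt; apply/negP => q1.
  have p4 : p ^+ 4 < 1 by rewrite exprn_ilt1.
  have q4 : q ^+ 4 < 1 by rewrite exprn_ilt1.
  lra.
have intf : mu.-integrable `]a, b[ (EFin \o f).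
  apply: (@integrable_bounded_primitive _ a b (`|e| * (2 + 2)) f F) => //.
  - move=> x xab; have [A0 B0] := AB_gt0 _ xab.
    have ccos : {for x, continuous cos} by exact: continuous_cos.
    have csin : {for x, continuous sin} by exact: continuous_sin.
    apply: cvgM; first exact: cvg_cst.
    apply: cvgD; apply: cvgM => //; apply: cr => //.
      by apply: cvgB => //; exact: cvg_cst.
    by apply: cvgD => //; exact: cvg_cst.
  - by move=> x /wf [].
  - move=> x xab; have [A0 B0] := AB_gt0 _ xab.
    have dA : is_derive x 1 A (sin x).
      have := is_deriveB (is_derive_cst (1 : R) x 1) (is_derive_cos x).
      by rewrite sub0r opprK.
    have dB : is_derive x 1 B (- sin x).
      have := is_deriveD (is_derive_cst (1 : R) x 1) (is_derive_cos x).
      by rewrite add0r.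
    have dsA : is_derive x 1 (fun y => Num.sqrt (A y)) ((2 * Num.sqrt (A x))^-1 * sin x).
      by apply: is_derive1_comp; exact: is_derive1_sqrt.
    have dsB : is_derive x 1 (fun y => Num.sqrt (B y)) ((2 * Num.sqrt (B x))^-1 * - sin x).
      by apply: is_derive1_comp; exact: is_derive1_sqrt.
    have dssA : is_derive x 1 (fun y => Num.sqrt (Num.sqrt (A y)))
        ((2 * Num.sqrt (Num.sqrt (A x)))^-1 * ((2 * Num.sqrt (A x))^-1 * sin x)).
      apply: (@is_derive1_comp _ Num.sqrt (fun y => Num.sqrt (A y))).
      by apply: is_derive1_sqrt; rewrite sqrtr_gt0.
    have dssB : is_derive x 1 (fun y => Num.sqrt (Num.sqrt (B y)))
        ((2 * Num.sqrt (Num.sqrt (B x)))^-1 * ((2 * Num.sqrt (B x))^-1 * - sin x)).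
      apply: (@is_derive1_comp _ Num.sqrt (fun y => Num.sqrt (B y))).
      by apply: is_derive1_sqrt; rewrite sqrtr_gt0.
    have := is_deriveZ e (is_deriveB dssA dssB).
    set d := _ *: _ => H.
    have -> : f x = d by rewrite /d /f /r4 /GRing.scale /= mulrN mulrN opprK !mulrA.
    exact: H.
  - move=> x _; rewrite normrM ler_wpM2l//.
    have s2 (y : R) : 0 <= y <= 2 -> 0 <= Num.sqrt (Num.sqrt y) <= 2.
      move=> /andP[y0 y2]; rewrite sqrtr_ge0 /=.
      rewrite leNgt; apply/negP => h.
      have := sq4 y y0; apply/eqP; rewrite gt_eqF// (le_lt_trans y2)//.
      by rewrite (@lt_trans _ _ (2 ^+ 4))// ?ltrXn2r//; lra.
    have /andP[h1 h2] : 0 <= Num.sqrt (Num.sqrt (A x)) <= 2.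
      by apply: s2; rewrite A_ge0 /=; have := B_ge0 x; have := AB2 x; lra.
    have /andP[h3 h4] : 0 <= Num.sqrt (Num.sqrt (B x)) <= 2.
      by apply: s2; rewrite B_ge0 /=; have := A_ge0 x; have := AB2 x; lra.
    by rewrite (le_trans (ler_normB _ _))// !ger0_norm// lerD.
have xreg x : x \in `]a, b[ -> {for x, continuous weight}.
  move=> /esin esx.
  have st : sin x != 0 by apply: contraTneq esx => ->; rewrite mulr0 ltxx.
  exact: weight_continuous.
apply: (@le_integrable _ _ _ mu _ _ _ (EFin \o (fun x => 4 * f x))).
- exact: measurable_itv.
- apply/measurable_EFinP; apply: open_continuous_measurable_fun => // x.
  by rewrite in_setE => /xreg.
- move=> x /wf [f0 wfx].
  have w0 : 0 <= weight x by rewrite invr_ge0 sqrtr_ge0.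
  by rewrite lee_fin !ger0_norm// mulr_ge0.
have -> : EFin \o (fun x => 4 * f x) = (fun x => 4%:E * (EFin \o f) x)%E by [].
exact: integrableZl.
Qed.

Lemma integrable_weight : mu.-integrable regular (EFin \o weight).
Proof.
have i1 : mu.-integrable `]- pi, 0[ (EFin \o weight).
  apply: (@integrable_weight_itv _ _ (-1)); first by rewrite oppr_lt0 pi_gt0.
    by rewrite sqrrN expr1n.
  move=> x; rewrite in_itv /= mulN1r -sinN => /andP[h1 h2].
  by rewrite sin_gt0_pi// oppr_gt0 h2 ltrNl.
have i2 : mu.-integrable `]0, pi[ (EFin \o weight).
  apply: (@integrable_weight_itv _ _ 1); first by rewrite pi_gt0.
    by rewrite expr1n.
  by move=> x; rewrite in_itv /= mul1r => /sin_gt0_pi.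
have [m1 h1] := integrableP _ _ _ i1; have [m2 h2] := integrableP _ _ _ i2.
have mw : measurable_fun regular (EFin \o weight).
  by apply/measurable_funU => //; exact: measurable_itv.
apply/integrableP; split => //.
rewrite ge0_integral_setU//=.
- by rewrite lte_add_pinfty.
- by do 2 apply: measurableT_comp => //; exact/measurable_EFinP.
- apply/disj_setPS => x []; rewrite /= !in_itv /= => /andP[_ a] /andP[b _].
  by have := lt_trans a b; rewrite ltxx.
Qed.

End weight.

(** * Iterated integrals *)

Section iterated.
Variable R : realType.
Notation mu := (@lebesgue_measure R).
Notation regular := (@regular R).
Notation box := (`[- pi, pi]%classic : set R).

Definition upd (v : nat -> R) (n : nat) (t : R) : nat -> R :=
  fun i => if i == n then t else v i.

Definition reg (v : nat -> R) : Prop := forall i, regular (v i).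

Lemma reg_upd v n t : reg v -> regular t -> reg (upd v n t).
Proof. by move=> rv rt i; rewrite /upd; case: ifP. Qed.

(** Continuity along coordinatewise convergent sequences is the form that dominated convergence
    delivers, so it survives integration in one coordinate; it also makes each section
    measurable. *)
Definition seqcont (H : (nat -> R) -> R) : Prop :=
  forall (a : nat -> nat -> R) (v : nat -> R), (forall k, reg (a k)) -> reg v ->
  (forall i, a k i @[k --> \oo] --> v i) -> H (a k) @[k --> \oo] --> H v.

Implicit Types (H K : (nat -> R) -> R) (v w : nat -> R).

Variable N : nat.

(** Coordinates below [n] are those already integrated out, so their weights have left the bound. *)
Definition dominated (n : nat) (H : (nat -> R) -> R) : Prop :=
  exists C, forall v, reg v -> `|H v| <= C * \prod_(n <= i < N) weight (v i).

Definition tame n H := seqcont H /\ dominated n H.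

Definition slice (n : nat) (H : (nat -> R) -> R) (v : nat -> R) : R :=
  \int[mu]_(t in box) H (upd v n t).

Lemma box_regular : box `\` [set - pi; 0; pi] = regular.
Proof.
have pi0 : 0 < pi :> R by exact: pi_gt0.
apply/seteqP; split=> t.
  rewrite /= in_itv /= => -[/andP[h1 h2] h].
  have n1 : t != - pi by apply/eqP => e; apply: h; left; left.
  have n2 : t != 0 by apply/eqP => e; apply: h; left; right.
  have n3 : t != pi by apply/eqP => e; apply: h; right.
  have [t0|t0] : t < 0 \/ 0 < t by apply/orP; rewrite -neq_lt.
    by left; rewrite /= in_itv /= t0 andbT lt_neqAle eq_sym n1.
  by right; rewrite /= in_itv /= t0 /= lt_neqAle n3.
case; rewrite /= !in_itv /= => /andP[h1 h2]; split.
- by apply/andP; split; lra.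
- by move=> [[]|] e; move: h1 h2; rewrite e; lra.
- by apply/andP; split; lra.
- by move=> [[]|] e; move: h1 h2; rewrite e; lra.
Qed.

(** The three missing points are null, so the conventional values of the integrand there, such as
    those from a division by zero, do not affect the integral. *)
Lemma Rintegral_box (f : R -> R) : mu.-integrable regular (EFin \o f) ->
  \int[mu]_(t in box) f t = \int[mu]_(t in regular) f t.
Proof.
move=> /integrableP [mf fi].
have mS : measurable ([set - pi; 0; pi] : set R).
  by apply: measurableU => //; apply: measurableU.
have S0 : mu [set - pi; 0; pi] = 0%E.
  rewrite !null_set_setU//; first exact: measurableU.
  - exact: lebesgue_measure_set1.
  - exact: lebesgue_measure_set1.
  - exact: lebesgue_measure_set1.
have pi0 : 0 < pi :> R by exact: pi_gt0.
have boxE : box = regular `|` [set - pi; 0; pi].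
  rewrite -box_regular setDKU// => t [[->|->]|->]; rewrite /= in_itv /=; apply/andP; split; lra.
have mbox : measurable_fun box (EFin \o f).
  rewrite boxE; apply/measurable_funU => //; first exact: regular_measurable.
  split => //; apply/measurable_funU => //; first exact: measurableU.
  split; last exact: measurable_fun_set1.
  by apply/measurable_funU => //; split; exact: measurable_fun_set1.
congr fine; rewrite -box_regular; apply: (@negligible_integral _ _ R mu) => //.
apply/integrableP; split => //.
rewrite (@ge0_negligible_integral _ _ R mu _ _ _ mS) ?box_regular//.
exact: measurableT_comp.
Qed.

Lemma dominated_upd n H C v t : (n < N)%N ->
  (forall v, reg v -> `|H v| <= C * \prod_(n <= i < N) weight (v i)) ->
  reg v -> regular t ->
  `|H (upd v n t)| <= C * (\prod_(n.+1 <= i < N) weight (v i)) * weight t.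
Proof.
move=> nN HC rv rt; apply: le_trans (HC _ (reg_upd n rv rt)) _.
rewrite big_ltn// {1}/upd eqxx -mulrA [weight t * _]mulrC.
rewrite (@eq_big_nat _ _ _ _ _ _ (fun i => weight (v i)))//.
by move=> i /andP[ni _]; rewrite /upd gtn_eqF.
Qed.

Lemma tame_continuous H v n : seqcont H -> reg v ->
  forall t, regular t -> {for t, continuous (fun t => H (upd v n t))}.
Proof.
move=> cH rv t rt; apply/(@cvg_nbhsP _ R^o) => u ut.
(* A sequence tending to [t] is regular only eventually, while [seqcont] asks for regularity
   throughout; the stray terms are replaced by the limit. *)
pose u' k := if u k \in regular then u k else t.
have ru' k : regular (u' k) by rewrite /u'; case: ifPn => //; rewrite in_setE.
have uu' : \forall k \near \oo, u k = u' k.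
  have : \forall k \near \oo, regular (u k).
    by apply: ut; apply: open_nbhs_nbhs; split => //; exact: regular_open.
  by apply: filterS => k rk; rewrite /u' mem_set.
have u't : u' k @[k --> \oo] --> t.
  by apply: cvg_trans ut; apply: near_eq_cvg.
apply: cvg_trans (cH (fun k => upd v n (u' k)) (upd v n t) _ _ _).
- by apply: near_eq_cvg; apply: filterS uu' => k ->.
- by move=> k; exact: reg_upd.
- exact: reg_upd.
- by move=> i; rewrite /upd; case: ifP => // _; exact: cvg_cst.
Qed.

Lemma tame_measurable H v n : seqcont H -> reg v ->
  measurable_fun regular (fun t => H (upd v n t)).
Proof.
move=> cH rv; apply: open_continuous_measurable_fun; first exact: regular_open.
by move=> t; rewrite in_setE; exact: tame_continuous.
Qed.

Lemma integrable_weightZ (c : R) :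
  mu.-integrable regular (EFin \o (fun t => c * weight t)).
Proof.
have -> : EFin \o (fun x => c * weight x) = (fun x => c%:E * (EFin \o (@weight R)) x)%E by [].
by apply: integrableZl; [exact: regular_measurable | exact: integrable_weight].
Qed.

Lemma tame_integrable H v n : (n < N)%N -> tame n H -> reg v ->
  mu.-integrable regular (EFin \o (fun t => H (upd v n t))).
Proof.
move=> nN [cH [C HC]] rv.
apply: (@le_integrable _ _ _ mu _ _ _
  (EFin \o (fun t => C * (\prod_(n.+1 <= i < N) weight (v i)) * weight t))).
- exact: regular_measurable.
- by apply/measurable_EFinP; exact: tame_measurable.
- move=> t rt; rewrite lee_fin (le_trans (dominated_upd nN HC rv rt))//.
  exact: ler_norm.
- exact: integrable_weightZ.
Qed.

Lemma sliceE H v n : (n < N)%N -> tame n H -> reg v ->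
  slice n H v = \int[mu]_(t in regular) H (upd v n t).
Proof. by move=> nN tH rv; apply: Rintegral_box; exact: tame_integrable. Qed.

Lemma eq_slice H K v n : (n < N)%N -> tame n H -> tame n K ->
  (forall v, reg v -> H v = K v) -> reg v -> slice n H v = slice n K v.
Proof.
move=> nN tH tK HK rv; rewrite !sliceE//; apply: eq_Rintegral => t; rewrite in_setE => rt.
by rewrite HK//; exact: reg_upd.
Qed.

Lemma slice_ge0 H v n : (n < N)%N -> tame n H ->
  (forall v, reg v -> 0 <= H v) -> reg v -> 0 <= slice n H v.
Proof.
move=> nN tH H0 rv; rewrite sliceE//; apply: Rintegral_ge0 => t rt.
by apply: H0; exact: reg_upd.
Qed.

Lemma slice_linear a H K v n : (n < N)%N -> tame n H -> tame n K -> reg v ->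
  slice n (fun v => a * H v + K v) v = a * slice n H v + slice n K v.
Proof.
move=> nN tH tK rv.
have iH := tame_integrable nN tH rv; have iK := tame_integrable nN tK rv.
have iaH : mu.-integrable regular (EFin \o (fun t => a * H (upd v n t))).
  have -> : EFin \o (fun t => a * H (upd v n t)) =
    (fun t => a%:E * (EFin \o (fun t => H (upd v n t))) t)%E by [].
  by apply: integrableZl => //; exact: regular_measurable.
rewrite /slice !Rintegral_box//.
  rewrite RintegralD//; last exact: regular_measurable.
  by rewrite RintegralZl//; exact: regular_measurable.
have -> : EFin \o (fun t => a * H (upd v n t) + K (upd v n t)) =
  ((EFin \o (fun t => a * H (upd v n t))%R) \+ (EFin \o (fun t => K (upd v n t))%R))%E by [].
by apply: integrableD => //; exact: regular_measurable.
Qed.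

Lemma weight_prod_cvg n (a : nat -> nat -> R) v :
  (forall k, reg (a k)) -> reg v -> (forall i, a k i @[k --> \oo] --> v i) ->
  \prod_(n <= i < N) weight (a k i) @[k --> \oo] --> \prod_(n <= i < N) weight (v i).
Proof.
move=> ra rv av.
elim: (index_iota n N) => [|i s IH].
  by rewrite big_nil; under eq_cvg do rewrite big_nil; exact: cvg_cst.
rewrite big_cons; under eq_cvg do rewrite big_cons.
apply: cvgM => //; apply: (@cvg_comp _ _ _ (fun k => a k i) (@weight R)); first exact: av.
by apply: weight_continuous; exact: regular_sin_neq0.
Qed.

(** Along a convergent regular sequence the product of the remaining weights converges, hence is
    bounded, and a constant times [weight] is an integrable majorant for dominated convergence. The
    domination constant gets multiplied by the integral of [weight]. *)
Lemma tame_slice H n : (n < N)%N -> tame n H -> tame n.+1 (slice n H).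
Proof.
move=> nN tH; have [cH [C HC]] := tH; split.
  move=> a v ra rv av.
  have [M HM] : exists M, forall k, \prod_(n.+1 <= i < N) weight (a k i) <= M.
    have : cvgn (fun k => \prod_(n.+1 <= i < N) weight (a k i)).
      by apply/cvg_ex; eexists; exact: weight_prod_cvg rv av.
    move=> /cvg_seq_bounded/pinfty_ex_gt0[M M0 /= HM].
    by exists M => k; apply: le_trans (ler_norm _) (HM k I).
  rewrite sliceE//.
  under eq_cvg do rewrite sliceE//.
  apply: fine_cvg; rewrite fineK; last first.
    apply: integrable_fin_num; first exact: regular_measurable.
    exact: tame_integrable.
  have Cw k t : regular t -> `|H (upd (a k) n t)| <= `|C| * M * weight t.
    move=> rt; apply: le_trans (dominated_upd nN HC (ra k) rt) _.
    have w0 : 0 <= weight t by rewrite (le_trans _ (weight_ge1 rt)).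
    apply: ler_wpM2r => //.
    apply: le_trans (_ : `|C| * \prod_(n.+1 <= i < N) weight (a k i) <= _).
      apply: ler_wpM2r (ler_norm _); apply: prodr_ge0 => i _.
      exact: le_trans (weight_ge1 (ra k i)).
    exact: ler_wpM2l.
  apply: (@dominated_cvg _ _ _ mu _ (@regular_measurable R)
    (fun k t => (H (upd (a k) n t))%:E) _ (EFin \o (fun t => `|C| * M * weight t))) => //.
  - by move=> k; apply/measurable_EFinP; exact: tame_measurable.
  - move=> t rt; apply: cvg_EFin; first exact: nearW.
    apply: cH; [by move=> k; exact: reg_upd|exact: reg_upd|].
    by move=> i; rewrite /upd; case: ifP => // _; exact: cvg_cst.
  - exact: integrable_weightZ.
exists (C * \int[mu]_(t in regular) weight t) => v rv.
rewrite sliceE//.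
have mR := @regular_measurable R.
apply: le_trans (le_normr_Rintegral _ _) _ => //; first exact: tame_integrable.
rewrite mulrAC -RintegralZl//; last exact: integrable_weight.
apply: le_Rintegral => //.
- have /integrable_abse := tame_integrable nN tH rv.
  by apply: eq_integrable.
- exact: integrable_weightZ.
- by move=> t rt; exact: dominated_upd.
Qed.

Fixpoint slices (n : nat) (H : (nat -> R) -> R) : (nat -> R) -> R :=
  if n is n'.+1 then slice n' (slices n' H) else H.

Lemma tame_slices n H : (n <= N)%N -> tame 0 H -> tame n (slices n H).
Proof.
move=> + tH; elim: n => //= n IH nN; apply: tame_slice => //; apply: IH.
exact: ltnW.
Qed.

Lemma eq_slices n H K v : (n <= N)%N -> tame 0 H -> tame 0 K ->
  (forall v, reg v -> H v = K v) -> reg v -> slices n H v = slices n K v.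
Proof.
move=> + tH tK HK; elim: n v => [|n IH] v nN rv /=; first exact: HK.
apply: eq_slice => //.
- by apply: tame_slices => //; exact: ltnW.
- by apply: tame_slices => //; exact: ltnW.
- by move=> w rw; apply: IH => //; exact: ltnW.
Qed.

Lemma slices_ge0 n H v : (n <= N)%N -> tame 0 H ->
  (forall v, reg v -> 0 <= H v) -> reg v -> 0 <= slices n H v.
Proof.
move=> + tH H0; elim: n v => [|n IH] v nN rv /=; first exact: H0.
apply: slice_ge0 => //.
- by apply: tame_slices => //; exact: ltnW.
- by move=> w rw; apply: IH => //; exact: ltnW.
Qed.

Lemma tame_linear n a H K : tame n H -> tame n K ->
  tame n (fun v => a * H v + K v).
Proof.
move=> [cH [C HC]] [cK [D KD]]; split.
  move=> s v rs rv sv; apply: cvgD; last exact: cK.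
  by apply: cvgM; [exact: cvg_cst|exact: cH].
exists (`|a| * C + D) => v rv; apply: le_trans (ler_normD _ _) _.
rewrite mulrDl lerD ?KD// normrM -mulrA ler_wpM2l//.
exact: HC.
Qed.

Lemma slices_linear n a H K v : (n <= N)%N -> tame 0 H -> tame 0 K -> reg v ->
  slices n (fun v => a * H v + K v) v = a * slices n H v + slices n K v.
Proof.
move=> + tH tK; elim: n v => [|n IH] v nN rv //=.
have nN' := ltnW nN.
rewrite -slice_linear//; [|exact: tame_slices|exact: tame_slices].
apply: eq_slice => //; last by move=> w rw; exact: IH.
- by apply: tame_slices => //; exact: tame_linear.
- by apply: tame_linear; exact: tame_slices.
Qed.

End iterated.

(** * Tame integrands and their mean over the box *)

Section fourier.
Variable R : realType.
Notation mu := (@lebesgue_measure R).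
Implicit Types (H K : (nat -> R) -> R) (u v w : nat -> R) (z : pt).
Notation tame0 := (tame 8 0).

(** [iint] fills coordinates into the zero sequence, which is not regular, whereas [slices]
    overwrites a base point [v]. Reading the coordinates from [n] on in [v] makes both agree, and
    [v] can then be taken regular. *)
Lemma iint_slices n H v :
  iint n (fun u => H (fun i => if (i < n)%N then u i else v i)) = slices n H v.
Proof.
elim: n v => [//|n IH] v /=.
congr Rintegral; apply/funext => t; rewrite -IH; congr iint; apply/funext => u.
congr H; apply/funext => i; rewrite /upd ltnS leq_eqVlt.
by case: eqVneq => [->|]//=; rewrite ltnn.
Qed.

Lemma seqcont_coord i : seqcont (fun u : nat -> R => u i).
Proof. by move=> a v ra rv; exact. Qed.

Lemma seqcontM H K : seqcont H -> seqcont K -> seqcont (fun u => H u * K u).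
Proof. by move=> cH cK a v ra rv av; apply: cvgM; [exact: cH|exact: cK]. Qed.

Lemma seqcont_cst (c : R) : seqcont (fun=> c).
Proof. by move=> a v ra rv av; exact: cvg_cst. Qed.

Lemma seqcont_comp (f : R -> R) H : continuous f -> seqcont H ->
  seqcont (fun u => f (H u)).
Proof.
move=> cf cH a v ra rv av.
exact: (@cvg_comp _ _ _ (fun k => H (a k)) f _ _ _ (cH a v ra rv av) (cf _)).
Qed.

Lemma seqcont_sum (I : Type) (s : seq I) (F : I -> (nat -> R) -> R) :
  (forall i, seqcont (F i)) -> seqcont (fun u => \sum_(i <- s) F i u).
Proof.
move=> cF; elim: s => [|i s IH] a v ra rv av /=.
  under eq_fun do rewrite big_nil.
  by rewrite big_nil; exact: cvg_cst.
under eq_fun do rewrite big_cons.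
by rewrite big_cons; apply: cvgD; [exact: cF|exact: IH].
Qed.

Lemma prod_weight_ge1 n v : reg v -> 1 <= \prod_(n <= i < 8) weight (v i).
Proof.
move=> rv; elim: (index_iota n 8) => [|i s IH]; rewrite ?big_nil// big_cons.
by rewrite mulr_ege1 ?weight_ge1.
Qed.

Lemma tame_bounded n K (C : R) : seqcont K -> (forall v, reg v -> `|K v| <= C) ->
  tame 8 n K.
Proof.
move=> cK KC; split => //; exists `|C| => v rv.
rewrite (le_trans (KC v rv))// (le_trans (ler_norm _))// ler_peMr//.
exact: prod_weight_ge1.
Qed.

Lemma tame_mul_bounded n H K : seqcont K -> (forall v, reg v -> `|K v| <= 1) ->
  tame 8 n H -> tame 8 n (fun v => K v * H v).
Proof.
move=> cK K1 [cH [C HC]]; split; first exact: seqcontM.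
exists C => v rv; rewrite normrM (le_trans _ (HC v rv))// ler_piMl//.
exact: K1.
Qed.

Definition dot z u : R := \sum_(m < 8) u m * (z ord0 m)%:~R.
Definition sumsin2 u : R := \sum_(m < 8) sin (u m) ^+ 2.

Lemma seqcont_dot z : seqcont (dot z).
Proof.
apply: seqcont_sum => i; apply: seqcontM; first exact: seqcont_coord.
exact: seqcont_cst.
Qed.

Lemma seqcont_sin z : seqcont (fun u => sin (dot z u)).
Proof. by apply: seqcont_comp; [exact: continuous_sin|exact: seqcont_dot]. Qed.

Lemma seqcont_cos z : seqcont (fun u => cos (dot z u)).
Proof. by apply: seqcont_comp; [exact: continuous_cos|exact: seqcont_dot]. Qed.

Lemma seqcont_sin_coord i : seqcont (fun u : nat -> R => sin (u i)).
Proof. by apply: seqcont_comp; [exact: continuous_sin|exact: seqcont_coord]. Qed.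

Lemma sumsin2_gt0 u : reg u -> 0 < sumsin2 u.
Proof.
move=> ru; rewrite /sumsin2 big_ord_recl ltr_pwDl//.
  by rewrite lt_neqAle sqr_ge0 eq_sym sqrf_eq0 regular_sin_neq0.
by apply: sumr_ge0 => i _; exact: sqr_ge0.
Qed.

Lemma sin_le_sumsin2 u (l : 'I_8) : sin (u l) ^+ 2 <= sumsin2 u.
Proof.
rewrite /sumsin2 (bigD1 l)//= lerDl.
by apply: sumr_ge0 => i _; exact: sqr_ge0.
Qed.

(* AM-GM on the first four coordinates, the remaining weights being >= 1. *)
Lemma invsumsin2_le u : reg u ->
  (sumsin2 u)^-1 <= \prod_(0 <= i < 8) weight (u i).
Proof.
move=> ru; pose r i := Num.sqrt `|sin (u i)|.
have r0 i : 0 < r i by rewrite sqrtr_gt0 normr_gt0 regular_sin_neq0.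
have r4 i : sin (u i) ^+ 2 = r i ^+ 4.
  by rewrite (exprM _ 2 2) sqr_sqrtr// -normrX ger0_norm// sqr_ge0.
have w1 i : 1 <= weight (u i) by exact: weight_ge1.
have wr i : weight (u i) * r i = 1 by apply: mulVf; rewrite gt_eqF ?r0.
rewrite -[leLHS]mul1r ler_pdivrMr ?sumsin2_gt0//.
rewrite (big_cat_nat (n := 4))//=.
apply: (@le_trans _ _ ((\prod_(0 <= i < 4) weight (u i)) * sumsin2 u)).
  apply: (@le_trans _ _ ((\prod_(0 <= i < 4) weight (u i)) * (r 0%N * r 1%N * (r 2%N * r 3%N)))).
    rewrite !big_nat_recl// big_geq// mulr1.
    rewrite [leRHS](_ : _ = (weight (u 0%N) * r 0%N) * (weight (u 1%N) * r 1%N)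
      * ((weight (u 2%N) * r 2%N) * (weight (u 3%N) * r 3%N))); last by ring.
    by rewrite !wr !mulr1.
  apply: ler_wpM2l.
    by apply: prodr_ge0 => i _; rewrite (le_trans _ (w1 i)).
  have : r 0%N ^+ 4 + (r 1%N ^+ 4 + (r 2%N ^+ 4 + r 3%N ^+ 4)) <= sumsin2 u.
    rewrite /sumsin2 -!r4 -(big_mkord xpredT (fun i => sin (u i) ^+ 2)).
    rewrite (big_cat_nat (n := 4))//= -[leLHS]addr0 lerD//.
      by rewrite !big_nat_recl// big_geq// addr0.
    by apply: sumr_ge0 => i _; exact: sqr_ge0.
  apply: le_trans.
  (* AM-GM for four fourth powers, as two levels of a^2 + b^2 >= 2ab. Four factors are the right
     number because sin^2 is the fourth power of [r], the reciprocal of the weight. *)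
  have h1 : 0 <= (r 0%N ^+ 2 - r 1%N ^+ 2) ^+ 2 by exact: sqr_ge0.
  have h2 : 0 <= (r 2%N ^+ 2 - r 3%N ^+ 2) ^+ 2 by exact: sqr_ge0.
  have h3 : 0 <= (r 0%N * r 1%N - r 2%N * r 3%N) ^+ 2 by exact: sqr_ge0.
  have h4 : 0 <= (r 0%N * r 1%N) ^+ 2 + (r 2%N * r 3%N) ^+ 2 by rewrite addr_ge0// sqr_ge0.
  have : 0 <= r 0%N * r 1%N * (r 2%N * r 3%N) by rewrite !mulr_ge0// ltW.
  lra.
rewrite ler_wpM2r ?(ltW (sumsin2_gt0 ru))//.
rewrite ler_peMr// ?prod_weight_ge1//.
by apply: prodr_ge0 => i _; rewrite (le_trans _ (w1 i)).
Qed.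

Lemma tame_invsumsin2 : tame0 (fun u => (sumsin2 u)^-1).
Proof.
split.
  move=> a v ra rv av; apply: cvgV; first by rewrite gt_eqF// sumsin2_gt0.
  apply: (@seqcont_sum _ _ (fun (i : 'I_8) u => sin (u i) ^+ 2)) => //= i.
  by apply: seqcontM; exact: seqcont_sin_coord.
exists 1 => v rv; rewrite mul1r ger0_norm ?invsumsin2_le//.
by rewrite invr_ge0 ltW// sumsin2_gt0.
Qed.

(** A regular base point; the first eight coordinates are overwritten by the integration. *)
Definition mid : nat -> R := fun=> pi / 2.

Lemma reg_mid : reg mid.
Proof.
move=> i; right; rewrite /= in_itv /= /mid.
have := pi_gt0 R; move: pi => p p0.
by apply/andP; split; lra.
Qed.

(* Locked: without it, unification compares two means by unfolding the
   eight nested Lebesgue integrals. *)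
Definition mean : ((nat -> R) -> R) -> R := locked (fun H => slices 8 H mid).

Lemma meanE H : mean H = slices 8 H mid.
Proof. by rewrite /mean -lock. Qed.

Lemma iint_mean H : (forall u v, (forall i, (i < 8)%N -> u i = v i) -> H u = H v) ->
  iint 8 H = mean H.
Proof.
move=> hH; rewrite meanE -iint_slices; congr iint; apply/funext => u.
by apply: hH => i ->.
Qed.

Lemma mean_linear a H K : tame0 H -> tame0 K ->
  mean (fun v => a * H v + K v) = a * mean H + mean K.
Proof. by move=> tH tK; rewrite !meanE; apply: (@slices_linear _ 8) => //; exact: reg_mid. Qed.

Lemma eq_mean H K : tame0 H -> tame0 K -> (forall v, reg v -> H v = K v) ->
  mean H = mean K.
Proof. by move=> tH tK HK; rewrite !meanE; apply: (@eq_slices _ 8) => //; exact: reg_mid. Qed.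

Lemma mean_ge0 H : tame0 H -> (forall v, reg v -> 0 <= H v) -> 0 <= mean H.
Proof. by move=> tH H0; rewrite meanE; apply: (@slices_ge0 _ 8) => //; exact: reg_mid. Qed.

Lemma tame_cst (c : R) n : tame 8 n (fun=> c).
Proof. by apply: (@tame_bounded _ _ `|c|) => //; exact: seqcont_cst. Qed.

Lemma mean0 : mean (fun=> 0) = 0.
Proof.
have := mean_linear 1 (tame_cst 0 0) (tame_cst 0 0).
rewrite !mul1r addr0 => /eqP.
by rewrite -subr_eq subrr eq_sym => /eqP.
Qed.

Lemma meanZ a H : tame0 H -> mean (fun v => a * H v) = a * mean H.
Proof.
move=> tH; have := mean_linear a tH (tame_cst 0 0); rewrite mean0 addr0 => <-.
by congr mean; apply/funext => v; rewrite addr0.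
Qed.

Lemma meanD H K : tame0 H -> tame0 K -> mean (fun v => H v + K v) = mean H + mean K.
Proof.
move=> tH tK; have := mean_linear 1 tH tK; rewrite mul1r => <-.
by congr mean; apply/funext => v; rewrite mul1r.
Qed.

Lemma tameZ a H : tame0 H -> tame0 (fun v => a * H v).
Proof.
move=> tH; have := tame_linear a tH (tame_cst 0 0).
by congr tame; apply/funext => v; rewrite addr0.
Qed.

Lemma tameD H K : tame0 H -> tame0 K -> tame0 (fun v => H v + K v).
Proof.
move=> tH tK; have := tame_linear 1 tH tK.
by congr tame; apply/funext => v; rewrite mul1r.
Qed.

Lemma tame_sum (I : Type) (s : seq I) (F : I -> (nat -> R) -> R) :
  (forall i, tame0 (F i)) -> tame0 (fun v => \sum_(i <- s) F i v).
Proof.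
move=> tF; elim: s => [|i s IH].
  by under eq_fun do rewrite big_nil; exact: tame_cst.
by under eq_fun do rewrite big_cons; exact: tameD.
Qed.

Lemma mean_sum (I : Type) (s : seq I) (F : I -> (nat -> R) -> R) :
  (forall i, tame0 (F i)) ->
  mean (fun v => \sum_(i <- s) F i v) = \sum_(i <- s) mean (F i).
Proof.
move=> tF; elim: s => [|i s IH].
  by under eq_fun do rewrite big_nil; rewrite big_nil mean0.
under eq_fun do rewrite big_cons.
by rewrite meanD// ?IH ?big_cons//; exact: tame_sum.
Qed.

End fourier.

(** * Orthogonality and the fundamental solution *)

Section orthogonality.
Variable R : realType.
Notation mu := (@lebesgue_measure R).
Implicit Types (H K : (nat -> R) -> R) (u v w : nat -> R) (z : pt).
Notation tame0 := (tame 8 0).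

Lemma sin_natpi n : sin (n%:R * pi : R) = 0.
Proof.
elim: n => [|n IH]; first by rewrite mul0r sin0.
by rewrite -natr1 mulrDl mul1r sinD IH sinpi mul0r mulr0 addr0.
Qed.

Lemma sin_intpi (k : int) : sin (k%:~R * pi : R) = 0.
Proof.
by case: k => n; rewrite ?NegzE ?mulrNz ?mulNr ?sinN sin_natpi ?oppr0.
Qed.

(** The phase [c] stands for the part of [dot z u] carried by the other coordinates. *)
Lemma Rintegral_cos (k : int) (c : R) :
  \int[mu]_(t in `[- pi, pi]) cos (t * k%:~R + c) =
  if k == 0 then 2 * pi * cos c else 0.
Proof.
have pi0 := pi_gt0 R.
have [->|k0] := eqVneq k 0.
  under eq_Rintegral do rewrite mulr0 add0r.
  rewrite Rintegral_cst//= lebesgue_measure_itv /= lte_fin ifT; last by lra.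
  rewrite -EFinB /= opprK; ring.
have kR : k%:~R != 0 :> R by rewrite intr_eq0.
pose F t : R := (k%:~R)^-1 * sin (t * k%:~R + c).
pose f t : R := cos (t * k%:~R + c).
have df (t : R) : is_derive t 1 (fun t : R => t * k%:~R + c) k%:~R.
  have := is_deriveD (is_deriveM (is_derive_id t 1) (is_derive_cst (k%:~R : R) t 1)) (is_derive_cst c t 1).
  by rewrite scaler0 add0r addr0 /GRing.scale /= mulr1.
have dF (t : R) : is_derive t 1 F (f t).
  have := is_deriveZ (k%:~R)^-1 (is_derive1_comp (is_derive_sin _) (df t)).
  by rewrite /GRing.scale /= mulrCA mulVf// mulr1.
have cf : continuous f.
  move=> t; apply: (@continuous_comp _ _ _ (fun t : R => t * k%:~R + c)); last exact: continuous_cos.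
  apply: cvgD; last exact: cvg_cst.
  by apply: cvgM; [exact: cvg_id|exact: cvg_cst].
have cF : continuous F.
  by move=> t; apply: differentiable_continuous; apply/derivable1_diffP; case: (dF t).
rewrite /Rintegral (@continuous_FTC2 _ f F)//.
- have e1 : pi * k%:~R = k%:~R * pi :> R by rewrite mulrC.
  have e2 : - pi * k%:~R = - (k%:~R * pi) :> R by rewrite mulNr mulrC.
  rewrite -EFinB /= /F e1 e2 !sinD sinN sin_intpi cosN oppr0 !mul0r !add0r.
  by rewrite subrr.
- by lra.
- exact: continuous_subspaceT.
- split.
  + by move=> x _; case: (dF x).
  + exact: cvg_at_right_filter (cF _).
  + exact: cvg_at_left_filter (cF _).
- by move=> x _; rewrite derive1E; exact: derive_val.
Qed.

Lemma dot_upd z v n t (ln : (n < 8)%N) :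
  dot z (upd v n t) = t * (z ord0 (Ordinal ln))%:~R + dot z (upd v n 0).
Proof.
rewrite /dot (bigD1 (Ordinal ln))//= [in RHS](bigD1 (Ordinal ln))//=.
rewrite /upd eqxx mul0r add0r; congr (_ + _); apply: eq_bigr => i.
by rewrite -val_eqE /= => /negbTE ->.
Qed.

Lemma tame_sin z : tame0 (fun u : nat -> R => sin (dot z u)).
Proof.
apply: (@tame_bounded _ _ _ 1); first exact: seqcont_sin.
by move=> v _; rewrite ler_norml sin_geN1 sin_le1.
Qed.

Lemma tame_cos n z : tame 8 n (fun u : nat -> R => cos (dot z u)).
Proof.
apply: (@tame_bounded _ _ _ 1); first exact: seqcont_cos.
by move=> v _; rewrite ler_norml cos_geN1 cos_le1.
Qed.

Definition zero_upto n z := [forall i : 'I_8, (i < n)%N ==> (z ord0 i == 0)].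

(** When the first [n] entries of [z] vanish, the cosine ignores the coordinates already integrated,
    so the phase can still be written [dot z v]; otherwise one layer integrates to zero. *)
Lemma slices_cos n z v : (n <= 8)%N -> reg v ->
  slices n (fun u => cos (dot z u)) v =
  (zero_upto n z)%:R * (2 * pi) ^+ n * cos (dot z v).
Proof.
elim: n v => [|n IH] v nN rv.
  rewrite (_ : zero_upto 0 z) ?expr0 ?mul1r//.
  exact/forallP.
rewrite [LHS]/= (@eq_slice _ 8 _ (fun v =>
   ((zero_upto n z)%:R * (2 * pi) ^+ n) * cos (dot z v)))//.
- rewrite /slice; under eq_Rintegral do rewrite (dot_upd _ _ _ nN).
  rewrite RintegralZl//; last first.
    apply: continuous_compact_integrable; first exact: segment_compact.
    apply: continuous_subspaceT => t.
    apply: (@continuous_comp _ _ _ (fun t : R => t * (z ord0 (Ordinal nN))%:~R + _)); last exact: continuous_cos.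
    apply: cvgD; last exact: cvg_cst.
    by apply: cvgM; [exact: cvg_id|exact: cvg_cst].
  rewrite Rintegral_cos.
  have -> : zero_upto n.+1 z = zero_upto n z && (z ord0 (Ordinal nN) == 0).
    apply/forallP/andP => [h|[/forallP h1 h2] i].
      split; last by have := h (Ordinal nN); rewrite /= ltnS leqnn.
      by apply/forallP => i; apply/implyP => iN; have := h i; rewrite ltnS ltnW.
    rewrite ltnS leq_eqVlt; apply/implyP => /orP[/eqP e|iN]; last by have := h1 i; rewrite iN.
    by rewrite (_ : i = Ordinal nN)//; apply: val_inj.
  case: eqVneq => [z0|_]; last by rewrite andbF mulr0 !mul0r.
  have -> : dot z (upd v n 0) = dot z v.
    rewrite /dot; apply: eq_bigr => i _; rewrite /upd; case: eqP => // e.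
    have -> : i = Ordinal nN by apply: val_inj.
    by rewrite z0 !mulr0.
  by rewrite andbT exprSr !mulrA.
- by apply: tame_slices; [exact: ltnW|exact: tame_cos].
- have := tame_linear ((zero_upto n z)%:R * (2 * pi) ^+ n) (tame_cos n z)
     (tame_cst 0 n).
  by congr tame; apply/funext => w; rewrite addr0.
- by move=> w rw; apply: IH => //; exact: ltnW.
Qed.

Lemma mean_cos z : mean (fun u : nat -> R => cos (dot z u)) = (z == 0)%:R * (2 * pi) ^+ 8.
Proof.
rewrite meanE slices_cos//; last exact: reg_mid.
have [->|z0] := eqVneq z 0.
  rewrite (_ : zero_upto 8 0); last by apply/forallP => i; rewrite mxE eqxx implybT.
  by rewrite /dot big1 ?cos0 ?mulr1// => i _; rewrite mxE mulr0.
rewrite /zero_upto; case: forallP => [h|]; last by rewrite !mul0r.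
case/eqP: z0; apply/rowP => i; rewrite mxE; apply/eqP.
by have := h i; rewrite ltn_ord.
Qed.

Lemma dotD z z' u : dot (z + z') u = dot z u + dot z' u.
Proof.
rewrite /dot -big_split; apply: eq_bigr => i _.
by rewrite mxE intrD mulrDr.
Qed.

Lemma dotN z u : dot (- z) u = - dot z u.
Proof.
by rewrite /dot -sumrN; apply: eq_bigr => i _; rewrite mxE mulrNz mulrN.
Qed.

Lemma dot_ept (l : 'I_8) u : dot (ept l) u = u l.
Proof.
rewrite /dot (bigD1 l)//= big1 ?addr0; first by rewrite mxE eqxx mulr1.
by move=> i /negbTE il; rewrite mxE il mulr0.
Qed.

Lemma mean_sin_sin z z' : mean (fun u : nat -> R => sin (dot z u) * sin (dot z' u)) =
  ((z == z')%:R - (z == - z')%:R) / 2 * (2 * pi) ^+ 8.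
Proof.
have tc := tame_cos 0.
transitivity (mean (fun u : nat -> R => 2^-1 * (cos (dot (z - z') u) + -1 * cos (dot (z + z') u)))).
  by congr mean; apply/funext => u; rewrite !dotD !dotN cosB cosD; field.
have tN := tameZ (-1) (tc (z + z')).
have /= E1 := meanZ 2^-1 (tameD (tc (z - z')) tN); have /= E2 := meanD (tc (z - z')) tN.
have /= E3 := meanZ (-1) (tc (z + z')).
by rewrite E1 E2 E3 !mean_cos subr_eq0 addr_eq0; field.
Qed.

End orthogonality.

(** * Bessel's inequality and the difference equations of the kernel *)

Section fundamental_solution.
Variable R : realType.
Implicit Types (H K : (nat -> R) -> R) (u v w : nat -> R) (z : pt).
Notation tame0 := (tame 8 0).
Notation V := ((2 * pi : R) ^+ 8).

Lemma V_gt0 : 0 < V.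
Proof. by rewrite exprn_gt0// mulr_gt0 ?pi_gt0. Qed.

Lemma sum_delta (T : eqType) (s : seq T) (a : T -> R) x : uniq s ->
  \sum_(y <- s) a y * (x == y)%:R = (x \in s)%:R * a x.
Proof.
move=> us; have [xs|xs] := boolP (x \in s).
  rewrite (bigD1_seq x)//= eqxx mulr1 big1 ?addr0 ?mul1r// => y /negbTE.
  by rewrite eq_sym => ->; rewrite mulr0.
rewrite mul0r big_seq big1// => y ys.
have /negbTE -> : x != y by apply: contraNneq xs => ->.
by rewrite mulr0.
Qed.

(* Only [z' = z] and [z' = - z] contribute to the Gram matrix of the functions
   [sin (dot z)]; the coefficients being odd in [z], it is at most V times the
   identity. *)
Lemma bessel H (s : seq pt) : tame0 H -> tame0 (fun u => H u ^+ 2) -> uniq s ->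
  \sum_(z <- s) mean (fun u => sin (dot z u) * H u) ^+ 2 <= V * mean (fun u => H u ^+ 2).
Proof.
move=> tH tH2 us.
pose sn z u : R := sin (dot z u).
have sn1 z v : reg v -> `|sn z v| <= 1 by rewrite ler_norml sin_geN1 sin_le1.
have csn z : seqcont (sn z) by exact: seqcont_sin.
have tsH z : tame0 (fun u => sn z u * H u) by apply: tame_mul_bounded => // v; exact: sn1.
have tss z z' : tame0 (fun u => sn z u * sn z' u).
  by apply: tame_mul_bounded => //; [move=> v; exact: sn1|exact: tame_sin].
(* A nonzero [z] gives a sine of mean square V/2, shared by [z] and [- z]; dividing by V gives the
   exact projection when [s] is symmetric. *)
pose b z := mean (fun u => sn z u * H u); pose a z := b z / V.
have aN z : a (- z) = - a z.
  rewrite /a /b -mulNr; congr (_ / _).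
  rewrite -[RHS]mulN1r; have /= <- := meanZ (-1) (tsH z).
  by congr mean; apply/funext => u; rewrite /sn dotN sinN mulN1r mulNr.
have V0 := V_gt0.
have bE z : mean (fun u => sn z u * H u) = V * a z by rewrite mulrC divfK// gt_eqF.
clearbody a; clear b.
pose T := fun u => \sum_(z <- s) a z * sn z u.
have tTH : tame0 (fun u => \sum_(z <- s) a z * (sn z u * H u)).
  by apply: tame_sum => z; exact: tameZ.
have tsT z : tame0 (fun u => \sum_(z' <- s) a z' * (sn z u * sn z' u)).
  by apply: tame_sum => z'; exact: tameZ.
have tTT : tame0 (fun u => \sum_(z <- s) a z * (\sum_(z' <- s) a z' * (sn z u * sn z' u))).
  by apply: tame_sum => z; exact: tameZ.
have mTH : mean (fun u => \sum_(z <- s) a z * (sn z u * H u)) = V * \sum_(z <- s) a z ^+ 2.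
  have /= -> := mean_sum s (fun z => tameZ (a z) (tsH z)).
  rewrite mulr_sumr; apply: eq_bigr => z _.
  by have /= -> := meanZ (a z) (tsH z); rewrite bE mulrCA -expr2.
have mTT : mean (fun u => \sum_(z <- s) a z * (\sum_(z' <- s) a z' * (sn z u * sn z' u)))
    <= V * \sum_(z <- s) a z ^+ 2.
  have /= -> := mean_sum s (fun z => tameZ (a z) (tsT z)).
  rewrite mulr_sumr big_seq [leRHS]big_seq; apply: ler_sum => z zs.
  have /= -> := meanZ (a z) (tsT z).
  have /= -> := mean_sum s (fun z' => tameZ (a z') (tss z z')).
  have E z' : mean (fun u => a z' * (sn z u * sn z' u)) =
      V / 2 * (a z' * (z == z')%:R - a z' * (z == - z')%:R).
    by have /= -> := meanZ (a z') (tss z z'); rewrite mean_sin_sin; ring.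
  rewrite (eq_bigr _ (fun z' _ => E z')) -mulr_sumr sumrB.
  rewrite sum_delta// zs mul1r.
  (* The cross term is -a(z)^2 or 0, according to whether [- z] lies in [s]. *)
  have h : - (a z ^+ 2) <= a z * (\sum_(z' <- s) a z' * (z == - z')%:R).
    under eq_bigr do rewrite eq_sym eqr_oppLR eq_sym.
    rewrite sum_delta// aN; case: (_ \in _); last by rewrite mul0r mulr0 oppr_le0 sqr_ge0.
    by rewrite mul1r mulrN -expr2.
  rewrite mulrCA -mulrA; apply: ler_wpM2l; first exact: ltW.
  rewrite mulrBr -expr2; move: (a z ^+ 2) (a z * _) h => x y; clear; lra.
(* The integrand is (H - T)^2, expanded into the shapes whose means are known. *)
have mu0 : 0 <= mean (fun u => H u ^+ 2 + (-2 * (\sum_(z <- s) a z * (sn z u * H u)) +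
    \sum_(z <- s) a z * (\sum_(z' <- s) a z' * (sn z u * sn z' u)))).
  apply: mean_ge0; first by apply: tameD => //; apply: tameD => //; exact: tameZ.
  move=> v rv.
  have -> : \sum_(z <- s) a z * (sn z v * H v) = T v * H v.
    by rewrite mulr_suml; apply: eq_bigr => z _; rewrite mulrA.
  have -> : \sum_(z <- s) a z * (\sum_(z' <- s) a z' * (sn z v * sn z' v)) = T v * T v.
    rewrite mulr_suml; apply: eq_bigr => z _; rewrite -mulrA; congr (_ * _).
    by rewrite mulr_sumr; apply: eq_bigr => z' _; rewrite mulrCA.
  have -> : H v ^+ 2 + (-2 * (T v * H v) + T v * T v) = (H v - T v) ^+ 2 by ring.
  exact: sqr_ge0.
have /= E1 := meanD tH2 (tameD (tameZ (-2) tTH) tTT).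
have /= E2 := meanD (tameZ (-2) tTH) tTT.
have /= E3 := meanZ (-2) tTH.
rewrite E1 E2 E3 mTH in mu0.
have -> : \sum_(z <- s) mean (fun u => sin (dot z u) * H u) ^+ 2 = V * (V * \sum_(z <- s) a z ^+ 2).
  rewrite mulrA mulr_sumr; apply: eq_bigr => z _.
  by rewrite bE exprMn expr2.
rewrite ler_pM2l//; move: mu0 mTT; move: (mean _) (mean _) (V * _); clear => p q r; lra.
Qed.

(** On waves a unit-step central difference along [m] is multiplication by i sin u_m, and conj(D) D
    by minus [sumsin2]. Up to a factor -i this is the multiplier of the m-th difference of the Green
    function of conj(D) D. *)
Definition symbol (m : 'I_8) u : R := sin (u m) * (sumsin2 u)^-1.

Lemma symbol_tame m : tame0 (symbol m).
Proof.
apply: tame_mul_bounded; [exact: seqcont_sin_coord| |exact: tame_invsumsin2].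
by move=> v _; rewrite ler_norml sin_geN1 sin_le1.
Qed.

Lemma symbol_sq_tame m : tame0 (fun u => symbol m u ^+ 2).
Proof.
have -> : (fun u => symbol m u ^+ 2) =
    (fun u => (sin (u m) ^+ 2 * (sumsin2 u)^-1) * (sumsin2 u)^-1).
  by apply/funext => u; rewrite /symbol; ring.
have [ci _] := tame_invsumsin2 R.
apply: tame_mul_bounded; last exact: tame_invsumsin2.
  by apply: seqcontM => //; apply: seqcontM; exact: seqcont_sin_coord.
move=> v rv; have S0 := sumsin2_gt0 rv.
rewrite ger0_norm; last by apply: divr_ge0; [exact: sqr_ge0|exact: ltW].
by rewrite ler_pdivrMr// mul1r sin_le_sumsin2.
Qed.

Definition gradE (m : 'I_8) z : R := V^-1 * mean (fun u => sin (dot z u) * symbol m u).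

Lemma E1E z (m : 'I_8) :
  E1 R z ord0 m = (if val m == 0%N then 1 else -1) * gradE m z.
Proof.
have iE : iint 8 (fun u => sin (u m) / (\sum_(m < 8) sin (u m) ^+ 2)
    * sin (\sum_(m < 8) u m * (z ord0 m)%:~R)) =
    mean (fun u => sin (dot z u) * symbol m u).
  rewrite iint_mean.
    have -> : (fun u => sin (u m) / (\sum_(m < 8) sin (u m) ^+ 2)
      * sin (\sum_(m < 8) u m * (z ord0 m)%:~R)) =
      (fun u => sin (dot z u) * symbol m u) by apply/funext => u; rewrite mulrC.
    by [].
  move=> u v uv; rewrite uv//; congr (_ / _ * sin _).
    by apply: eq_bigr => i _; rewrite uv.
  by apply: eq_bigr => i _; rewrite uv.
by rewrite mxE iE /gradE mulrA.
Qed.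

(** The Bessel bound is uniform over finite families, so only finitely many coefficients can reach
    [e]. *)
Lemma gradE_finite (m : 'I_8) (e : R) : 0 < e ->
  finite_set [set z | e <= `|gradE m z|].
Proof.
move=> e0; apply: contrapT => inf.
have V0 := V_gt0.
have [M BM] : exists M, forall s : seq pt, uniq s ->
    \sum_(z <- s) mean (fun u => sin (dot z u) * symbol m u) ^+ 2 <= M.
  by eexists => s us; exact: bessel (symbol_tame m) (symbol_sq_tame m) us.
pose c := V^-1 ^+ 2 * M.
(* More than c / e^2 points, each contributing at least e^2, would exceed the bound [c]. *)
have [s sub sz] := infinite_set_fset (Num.truncn (c / e ^+ 2)).+1 inf.
have h : \sum_(z <- s) gradE m z ^+ 2 <= c.
  have -> : \sum_(z <- s) gradE m z ^+ 2 = V^-1 ^+ 2 *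
      \sum_(z <- s) mean (fun u => sin (dot z u) * symbol m u) ^+ 2.
    by rewrite mulr_sumr; apply: eq_bigr => z _; rewrite exprMn.
  apply: ler_wpM2l; first exact: sqr_ge0.
  by apply: BM; exact: fset_uniq.
have h2 : e ^+ 2 *+ size s <= \sum_(z <- s) gradE m z ^+ 2.
  rewrite -[size s]card_ord -sumr_const (big_nth 0) big_mkord; apply: ler_sum => i _.
  rewrite -[leRHS]real_normK ?num_real// lerXn2r ?nnegrE ?(ltW e0)//.
  by apply: sub; rewrite /= mem_nth.
have := le_trans h2 h; rewrite -mulr_natl -ler_pdivlMr ?exprn_gt0//.
apply/negP; rewrite -ltNge (lt_le_trans (truncnS_gt _))// ler_nat.
by [].
Qed.

(** From sin(a + b) - sin(a - b) = 2 cos a sin b: differencing along [l] inserts the bounded factor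
    sin u_l, which makes the integrand symmetric in [l] and [m]. *)
Lemma gradE_diff (l m : 'I_8) z : gradE m (z + ept l) - gradE m (z - ept l) =
  V^-1 * (2 * mean (fun u => cos (dot z u) * (sin (u l) * symbol m u))).
Proof.
have tc : tame0 (fun u => cos (dot z u) * (sin (u l) * symbol m u)).
  apply: tame_mul_bounded; first exact: seqcont_cos.
    by move=> v _; rewrite ler_norml cos_geN1 cos_le1.
  apply: tame_mul_bounded; [exact: seqcont_sin_coord| |exact: symbol_tame].
  by move=> v _; rewrite ler_norml sin_geN1 sin_le1.
have ts z' : tame0 (fun u => sin (dot z' u) * symbol m u).
  apply: tame_mul_bounded; [exact: seqcont_sin| |exact: symbol_tame].
  by move=> v _; rewrite ler_norml sin_geN1 sin_le1.
rewrite /gradE -mulrBr; congr (_ * _).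
have /= <- := meanZ 2 tc.
have /= E := meanD (ts (z + ept l)) (tameZ (-1) (ts (z - ept l))).
have /= E' := meanZ (-1) (ts (z - ept l)).
rewrite -mulN1r -E' -E; congr mean; apply/funext => u.
by rewrite !dotD dotN dot_ept sinD sinB; ring.
Qed.

Lemma gradE_diffC (l m : 'I_8) z :
  gradE m (z + ept l) - gradE m (z - ept l) = gradE l (z + ept m) - gradE l (z - ept m).
Proof.
rewrite (gradE_diff l m z) (gradE_diff m l z).
have -> : (fun u => cos (dot z u) * (sin (u l) * symbol m u)) =
    (fun u => cos (dot z u) * (sin (u m) * symbol l u)).
  by apply/funext => u; rewrite /symbol; ring.
by [].
Qed.

(** Summing over [l] cancels the denominator of the symbol, leaving the mean of a pure cosine. *)
Lemma gradE_div z :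
  \sum_(l < 8) (gradE l (z + ept l) - gradE l (z - ept l)) = 2 * (z == 0)%:R.
Proof.
have V0 := V_gt0.
have tc (l : 'I_8) : tame0 (fun u => cos (dot z u) * (sin (u l) * symbol l u)).
  apply: tame_mul_bounded; first exact: seqcont_cos.
    by move=> v _; rewrite ler_norml cos_geN1 cos_le1.
  apply: tame_mul_bounded; [exact: seqcont_sin_coord| |exact: symbol_tame].
  by move=> v _; rewrite ler_norml sin_geN1 sin_le1.
rewrite (eq_bigr _ (fun l _ => gradE_diff l l z)).
rewrite -!mulr_sumr.
have /= <- := mean_sum (index_enum 'I_8) tc.
rewrite (@eq_mean _ _ (fun u => cos (dot z u))).
- by rewrite mean_cos [_%:R * V]mulrC mulrCA mulKf// gt_eqF.
- exact: tame_sum.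
- exact: tame_cos.
- move=> v rv; have S0 := sumsin2_gt0 rv.
  rewrite -mulr_sumr; under eq_bigr do rewrite /symbol mulrA -expr2.
  by rewrite -mulr_suml -/(sumsin2 v) divff ?mulr1// gt_eqF.
Qed.

End fundamental_solution.

(** * Octonions *)

Definition osgn (l : nat) : int := if l == 0%N then 1 else -1.

(** An integer copy of the structure constants, so that identities between basis elements are
    decided by computation. *)
Definition epsz (i j k : nat) : int :=
  if has (fun t => let: (a,b,c) := t in
            [|| ((a,b,c) == (i,j,k)), ((b,c,a) == (i,j,k)) | ((c,a,b) == (i,j,k))])
         pos_triples then 1
  else if has (fun t => let: (a,b,c) := t in
            [|| ((b,a,c) == (i,j,k)), ((a,c,b) == (i,j,k)) | ((c,b,a) == (i,j,k))])
         pos_triples then -1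
  else 0.

Definition mcoefz (i j k : nat) : int :=
  if i == 0%N then ((j == k)%:R)
  else if j == 0%N then ((i == k)%:R)
  else - ((i == j) && (k == 0%N))%:R + epsz i j k.

(* e_i e_j = oct_sg i j * e_(oct_ix i j) *)
Definition oct_ix (i j : nat) : nat := find (fun k => mcoefz i j k != 0) (iota 0 8).

Definition oct_sg (i j : nat) : int := mcoefz i j (oct_ix i j).

(** The sign of the basis product e_m (e_l e_j); [oct_ix2] is its index. *)
Definition oct_sg2 (m l j : nat) : int := oct_sg l j * oct_sg m (oct_ix l j).

Definition oct_ix2 (m l j : nat) : nat := oct_ix m (oct_ix l j).

Definition check_monomial :=
  all (fun i => all (fun j =>
    (oct_ix i j \in iota 0 8) && all (fun k =>
      mcoefz i j k == if k == oct_ix i j then oct_sg i j else 0)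
  (iota 0 8)) (iota 0 8)) (iota 0 8).

(** For l different from m, e_m (e_l e_j) and e_l (e_m e_j) are multiples of one basis element. The
    two sign relations put the conjugation on the outer and on the inner factor respectively. *)
Definition check_clifford :=
  all (fun l => all (fun m => all (fun j =>
    if l == m then (oct_ix2 m l j == j) && (osgn m * oct_sg2 m l j == 1)
    else [&& oct_ix2 m l j == oct_ix2 l m j,
      osgn m * oct_sg2 m l j + osgn l * oct_sg2 l m j == 0 &
      osgn l * oct_sg2 m l j + osgn m * oct_sg2 l m j == 0])
  (iota 0 8)) (iota 0 8)) (iota 0 8).

Lemma check_monomialP : check_monomial.
Proof. by vm_compute. Qed.

Lemma check_cliffordP : check_clifford.
Proof. by vm_compute. Qed.

Section octonions.
Variable R : realType.
Implicit Types (a b c w : oct R).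

Lemma octDE a b k : (a + b) ord0 k = a ord0 k + b ord0 k.
Proof. by rewrite mxE. Qed.

Lemma octZE (t : R) a k : (t *: a) ord0 k = t * a ord0 k.
Proof. by rewrite mxE. Qed.

Lemma mcoefE (i j k : 'I_8) : mcoef R i j k = (mcoefz i j k)%:~R.
Proof.
rewrite /mcoef /mcoefz -!val_eqE /=; case: ifP => _; first by case: eqP.
case: ifP => _; first by case: eqP.
rewrite rmorphD rmorphN /=; congr (- _ + _); first by case: (_ && _).
by rewrite /epsi /epsz; case: ifP => _ //; case: ifP => _ //; rewrite rmorphN1.
Qed.

Lemma omulDl a b c : omul (a + b) c = omul a c + omul b c.
Proof.
apply/rowP => k; rewrite !mxE -big_split; apply: eq_bigr => i _ /=.
by rewrite -big_split; apply: eq_bigr => j _ /=; rewrite mxE !mulrDl.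
Qed.

Lemma omulDr a b c : omul a (b + c) = omul a b + omul a c.
Proof.
apply/rowP => k; rewrite !mxE -big_split; apply: eq_bigr => i _ /=.
by rewrite -big_split; apply: eq_bigr => j _ /=; rewrite mxE mulrDr !mulrDl.
Qed.

Lemma omulZl (t : R) a c : omul (t *: a) c = t *: omul a c.
Proof.
apply/rowP => k; rewrite !mxE mulr_sumr; apply: eq_bigr => i _ /=.
by rewrite mulr_sumr; apply: eq_bigr => j _ /=; rewrite mxE !mulrA.
Qed.

Lemma omulZr (t : R) a c : omul a (t *: c) = t *: omul a c.
Proof.
apply/rowP => k; rewrite !mxE mulr_sumr; apply: eq_bigr => i _ /=.
by rewrite mulr_sumr; apply: eq_bigr => j _ /=; rewrite mxE; ring.
Qed.

Lemma omul0r a : omul a 0 = 0.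
Proof. by rewrite -(scale0r 0) omulZr !scale0r. Qed.

Lemma omul0l a : omul 0 a = 0.
Proof. by rewrite -(scale0r 0) omulZl !scale0r. Qed.

Lemma omulNr a b : omul a (- b) = - omul a b.
Proof. by rewrite -scaleN1r omulZr scaleN1r. Qed.

Lemma omulNl a b : omul (- a) b = - omul a b.
Proof. by rewrite -scaleN1r omulZl scaleN1r. Qed.

Lemma omulBl a b c : omul (a - b) c = omul a c - omul b c.
Proof. by rewrite omulDl omulNl. Qed.

Lemma omulBr a b c : omul a (b - c) = omul a b - omul a c.
Proof. by rewrite omulDr omulNr. Qed.

Lemma omul_suml (I : Type) (s : seq I) (P : pred I) (F : I -> oct R) c :
  omul (\sum_(i <- s | P i) F i) c = \sum_(i <- s | P i) omul (F i) c.
Proof.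
by apply: (big_morph (fun a => omul a c)) => [a b|]; rewrite ?omulDl ?omul0l.
Qed.

Lemma omul_sumr (I : Type) (s : seq I) (P : pred I) a (F : I -> oct R) :
  omul a (\sum_(i <- s | P i) F i) = \sum_(i <- s | P i) omul a (F i).
Proof. by apply: big_morph => [b c|]; rewrite ?omulDr ?omul0r. Qed.

Lemma omul_obas (l : 'I_8) w k : omul (obas R l) w ord0 k = \sum_(j < 8) w ord0 j * mcoef R l j k.
Proof.
rewrite mxE (bigD1 l)//= [X in _ + X]big1 ?addr0; last first.
  by move=> i /negbTE il; rewrite big1// => j _; rewrite mxE il !mul0r.
by apply: eq_bigr => j _; rewrite mxE eqxx mul1r.
Qed.

Let monomial (i j : 'I_8) : (oct_ix i j < 8)%N /\ forall k : 'I_8,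
  mcoefz i j k = if k == oct_ix i j :> nat then oct_sg i j else 0.
Proof.
have i8 (l : 'I_8) : val l \in iota 0 8 by rewrite mem_iota /=.
have /allP/(_ _ (i8 i))/allP/(_ _ (i8 j))/andP[h1 /allP h2] := check_monomialP.
split; first by move: h1; rewrite mem_iota.
by move=> k; have /eqP := h2 _ (i8 k).
Qed.

Lemma omul_obas2 (l m : 'I_8) w k : omul (obas R m) (omul (obas R l) w) ord0 k =
  \sum_(j < 8) w ord0 j * (if k == oct_ix2 m l j :> nat then oct_sg2 m l j else 0)%:~R.
Proof.
rewrite omul_obas; under eq_bigr do rewrite omul_obas mulr_suml.
rewrite exchange_big; apply: eq_bigr => j _ /=.
under eq_bigr do rewrite -mulrA.
rewrite -mulr_sumr; congr (_ * _).
have [ix8 mlj] := monomial l j.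
rewrite (bigD1 (Ordinal ix8))//= !mcoefE mlj eqxx (monomial m (Ordinal ix8)).2 /=.
rewrite big1 ?addr0 => [|i].
  by rewrite /oct_ix2 /oct_sg2; case: ifP => _; rewrite ?mulr0// intrM.
by rewrite -val_eqE /= mcoefE mlj => /negbTE ->; rewrite mul0r.
Qed.

Definition sgn (m : 'I_8) : R := (osgn m)%:~R.

Let clifford_int (l m j k : 'I_8) :
  let c m l := if k == oct_ix2 m l j :> nat then oct_sg2 m l j else 0 in
  (osgn m * c m l + osgn l * c l m = if (l == m) && (j == k) then 2 else 0) /\
  (osgn l * c m l + osgn m * c l m = if (l == m) && (j == k) then 2 else 0).
Proof.
move=> c; rewrite /c {c}.
have i8 (i : 'I_8) : val i \in iota 0 8 by rewrite mem_iota /=.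
have /allP/(_ _ (i8 l))/allP/(_ _ (i8 m))/allP/(_ _ (i8 j)) := check_cliffordP.
have [->|lm] := eqVneq l m.
  rewrite eqxx => /andP[/eqP -> /eqP e] /=; rewrite eq_sym val_eqE.
  by case: (j == k); rewrite ?mulr0 ?e.
rewrite val_eqE (negbTE lm) => /and3P[/eqP -> /eqP e1 /eqP e2] /=.
by case: (_ == _); rewrite ?mulr0.
Qed.

(* Polarised alternativity, [sgn m *: e_m] standing for conj(e_m). *)
Lemma clifford_l (l m : 'I_8) w :
  sgn m *: omul (obas R m) (omul (obas R l) w) +
  sgn l *: omul (obas R l) (omul (obas R m) w) = (if l == m then 2 else 0) *: w.
Proof.
apply/rowP => k; rewrite octDE !octZE !omul_obas2 !mulr_sumr -big_split /=.
under eq_bigr => j _.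
  rewrite mulrCA [X in _ + X]mulrCA -mulrDr /sgn -!intrM -intrD (clifford_int l m j k).1.
  over.
rewrite (bigD1 k)//= eqxx andbT big1 ?addr0.
  by case: eqP => _; rewrite mulrC.
by move=> j /negbTE ->; rewrite andbF mulr0.
Qed.

(** The conjugate sits on the inner factor, as when D is applied to the kernel; [clifford_l] serves
    the kernel multiplying e_l w. *)
Lemma clifford_r (l m : 'I_8) w :
  sgn l *: omul (obas R m) (omul (obas R l) w) +
  sgn m *: omul (obas R l) (omul (obas R m) w) = (if l == m then 2 else 0) *: w.
Proof.
apply/rowP => k; rewrite octDE !octZE !omul_obas2 !mulr_sumr -big_split /=.
under eq_bigr => j _.
  rewrite mulrCA [X in _ + X]mulrCA -mulrDr /sgn -!intrM -intrD (clifford_int l m j k).2.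
  over.
rewrite (bigD1 k)//= eqxx andbT big1 ?addr0.
  by case: eqP => _; rewrite mulrC.
by move=> j /negbTE ->; rewrite andbF mulr0.
Qed.

(** Adding the double sum to its transpose pairs (l, m) with (m, l), and only the diagonal survives.
    The symmetry of [w] is where that of mixed differences enters. *)
Let clifford_sum (c : 'I_8 -> 'I_8 -> R) (w : 'I_8 -> 'I_8 -> oct R) :
  (forall l m a, c l m *: omul (obas R m) (omul (obas R l) a) +
     c m l *: omul (obas R l) (omul (obas R m) a) = (if l == m then 2 else 0) *: a) ->
  (forall l m, w l m = w m l) ->
  \sum_(l < 8) \sum_(m < 8) c l m *: omul (obas R m) (omul (obas R l) (w l m)) =
  \sum_(l < 8) w l l.
Proof.
move=> cE ws; set S := LHS.
have E : S = \sum_(l < 8) \sum_(m < 8) c m l *: omul (obas R l) (omul (obas R m) (w l m)).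
  rewrite /S exchange_big; apply: eq_bigr => m _; apply: eq_bigr => l _ /=.
  by rewrite ws.
have : S + S = 2 *: \sum_(l < 8) w l l.
  rewrite {2}E /S -big_split scaler_sumr; apply: eq_bigr => l _ /=.
  rewrite -big_split (bigD1 l)//= cE eqxx big1 ?addr0// => m /negbTE ml.
  by rewrite cE eq_sym ml scale0r.
rewrite -[S in S + _]scale1r -[S in _ + S]scale1r -scalerDl.
by move/(congr1 (fun x => 2^-1 *: x)); rewrite !scalerA mulVf// !scale1r.
Qed.

Lemma clifford_sum_l (w : 'I_8 -> 'I_8 -> oct R) : (forall l m, w l m = w m l) ->
  \sum_(l < 8) \sum_(m < 8) sgn m *: omul (obas R m) (omul (obas R l) (w l m)) =
  \sum_(l < 8) w l l.
Proof. by apply: (@clifford_sum (fun l m => sgn m)) => l m a; exact: clifford_l. Qed.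

Lemma clifford_sum_r (w : 'I_8 -> 'I_8 -> oct R) : (forall l m, w l m = w m l) ->
  \sum_(l < 8) \sum_(m < 8) sgn l *: omul (obas R m) (omul (obas R l) (w l m)) =
  \sum_(l < 8) w l l.
Proof. by apply: (@clifford_sum (fun l m => sgn l)) => l m a; exact: clifford_r. Qed.

End octonions.

(** * Monogenic functions on the lattice *)

Section lattice.
Variable R : realType.
Implicit Types (x y z : pt) (phi psi : pt -> R) (f g : pt -> oct R).

(** Convergence to 0 at infinity on a discrete space, stated without a norm or a step and hence
    plainly invariant under translation. *)
Definition vanishing phi : Prop :=
  forall e : R, 0 < e -> finite_set [set y | e <= `|phi y|].

Lemma vanishingD phi psi : vanishing phi -> vanishing psi ->
  vanishing (fun y => phi y + psi y).
Proof.
move=> vp vq e e0; have e2 : 0 < e / 2 by rewrite divr_gt0.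
apply: sub_finite_set (_ : _ `<=` [set y | e / 2 <= `|phi y|] `|` [set y | e / 2 <= `|psi y|]) _.
  move=> y /= h; have [h1|h1] := leP (e / 2) `|phi y|; first by left.
  right; rewrite /=; have := ler_normD (phi y) (psi y); lra.
by rewrite finite_setU; split; [exact: vp|exact: vq].
Qed.

Lemma vanishingZ (a : R) phi : vanishing phi -> vanishing (fun y => a * phi y).
Proof.
move=> vp e e0; have a0 : 0 < `|a| + 1 by rewrite ltr_wpDl.
apply: sub_finite_set (_ : _ `<=` [set y | e / (`|a| + 1) <= `|phi y|]) _.
  move=> y /= h; rewrite ler_pdivrMr// (le_trans h)// normrM mulrC ler_wpM2l//.
  by rewrite lerDl.
by apply: vp; rewrite divr_gt0.
Qed.

Lemma vanishing0 : vanishing (fun=> 0).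
Proof.
move=> e e0; rewrite (_ : [set _ | _] = set0); first exact: finite_set0.
by apply/seteqP; split=> y //=; rewrite normr0 leNgt e0.
Qed.

Lemma vanishing_sum (I : Type) (s : seq I) (F : I -> pt -> R) :
  (forall i, vanishing (F i)) -> vanishing (fun y => \sum_(i <- s) F i y).
Proof.
move=> vF; elim: s => [|i s IH].
  by under eq_fun do rewrite big_nil; exact: vanishing0.
by under eq_fun do rewrite big_cons; exact: vanishingD.
Qed.

Lemma vanishing_shift phi x : vanishing phi -> vanishing (fun y => phi (y - x)).
Proof.
move=> vp e e0.
apply: sub_finite_set (finite_image (fun y => y + x) (vp e e0)) => y h.
by exists (y - x) => //=; rewrite subrK.
Qed.

Lemma finite_shift_invariant (A : set pt) (a : pt) : a != 0 -> finite_set A ->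
  (forall x, A x -> A (x + a)) -> A = set0.
Proof.
move=> a0 fA Aa; apply/seteqP; split=> // x Ax.
have iA n : A (x + a *+ n).
  by elim: n => [|n IH]; rewrite ?mulr0n ?addr0// mulrSr addrA; exact: Aa.
exfalso; apply: infinite_nat.
rewrite (_ : setT = (fun n => x + a *+ n) @^-1` A); last by apply/seteqP; split=> n _ //=; exact: iA.
apply: finite_preimage => // m n _ _ /addrI /eqP.
have [k ak] : exists k, a ord0 k != 0.
  apply: contrapT => h; move/eqP: a0; apply; apply/rowP => k; rewrite mxE.
  by apply/eqP; apply: contrapT => hk; apply: h; exists k; apply/negP.
move=> /eqP /rowP /(_ k); by rewrite !mulmxnE => /(mulrIn ak).
Qed.

(* At a maximum, each of the 16 neighbours x +- 2 e_l must also be a maximum;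
   translating forever contradicts finiteness of the superlevel set. *)
Lemma vanishing_harmonic_le0 phi : vanishing phi ->
  (forall x, \sum_(l < 8) (phi (x + ept l *+ 2) + phi (x - ept l *+ 2) - 2 * phi x) = 0) ->
  forall x, phi x <= 0.
Proof.
move=> vp hp x0; rewrite leNgt; apply/negP => p0.
pose A := [set y | phi x0 <= phi y].
have fA : finite_set A.
  by apply: sub_finite_set (vp _ p0) => y /= h; rewrite (le_trans h)// ler_norm.
have [m Am mmax] : exists2 m, A m & forall y, phi y <= phi m.
  pose s := fset_set A.
  have sA y : y \in s = (y \in A) by rewrite in_fset_set.
  have x0s : x0 \in s by rewrite sA; apply: mem_set; rewrite /A /=.
  pose i0 := [` x0s]%fset.
  pose i := [arg max_(i > i0) phi (val i)]%O.
  have imax (j : s) : phi (val j) <= phi (val i) by rewrite /i; case: arg_maxP => // k _ /(_ j isT).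
  have iA : A (val i) by apply: set_mem; rewrite -sA; exact: valP.
  exists (val i) => // y; have [ys|ys] := boolP (y \in s).
    exact: imax [` ys]%fset.
  apply: ltW; apply: lt_le_trans iA; rewrite ltNge.
  by move: ys; rewrite sA notin_setE => h; apply/negP.
pose M := [set y | phi y = phi m].
have fM : finite_set M.
  by apply: sub_finite_set fA => y yM; rewrite /A /= yM.
suff M0 : M = set0 by suff : M m; [rewrite M0|].
(* One direction is enough to escape to infinity: at a maximum every second difference is
   nonpositive, so each of them vanishes. *)
pose l0 : 'I_8 := ord0.
apply: (@finite_shift_invariant _ (ept l0 *+ 2)) => //.
  by apply/eqP => /rowP /(_ l0); rewrite mulmxnE !mxE eqxx.
move=> x Mx; apply/eqP; rewrite eq_le mmax /=.
have := hp x; rewrite (bigD1 l0)//= => h.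
have : \sum_(l < 8 | l != l0) (phi (x + ept l *+ 2) + phi (x - ept l *+ 2) - 2 * phi x) <= 0.
  apply: sumr_le0 => l _; rewrite Mx.
  have := mmax (x + ept l *+ 2); have := mmax (x - ept l *+ 2); lra.
have := mmax (x - ept l0 *+ 2); move: h; rewrite Mx.
move: (\sum_(l < 8 | _) _) => S; lra.
Qed.

Lemma vanishing_harmonic phi : vanishing phi ->
  (forall x, \sum_(l < 8) (phi (x + ept l *+ 2) + phi (x - ept l *+ 2) - 2 * phi x) = 0) ->
  forall x, phi x = 0.
Proof.
move=> vp hp x; apply/eqP; rewrite eq_le vanishing_harmonic_le0//=.
rewrite -oppr_le0 -mulN1r.
apply: (@vanishing_harmonic_le0 (fun y => -1 * phi y)); first exact: vanishingZ.
move=> y; transitivity (-1 *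
    \sum_(l < 8) (phi (y + ept l *+ 2) + phi (y - ept l *+ 2) - 2 * phi y)).
  by rewrite mulr_sumr; apply: eq_bigr => l _; ring.
by rewrite hp mulr0.
Qed.

(** The operator at step 1; [Dh] is a nonzero multiple of it and has the same zeros. *)
Definition D1 f x : oct R :=
  \sum_(l < 8) omul (obas R l) (2^-1 *: (f (x + ept l) - f (x - ept l))).

Lemma DhE h f x : Dh h f x = h^-1 *: D1 f x.
Proof.
rewrite /Dh /D1 scaler_sumr; apply: eq_bigr => l _.
by rewrite /dcent /dplus /dminus -scalerDr -omulZr !scalerA [h^-1 * _]mulrC addrA subrK.
Qed.

Lemma D1B f g x : D1 (fun y => f y - g y) x = D1 f x - D1 g x.
Proof.
rewrite /D1 -sumrB; apply: eq_bigr => l _; rewrite -omulBr -scalerBr.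
by congr (omul _ (_ *: _)); rewrite !opprD !opprK addrACA.
Qed.

Lemma D1_cst c x : D1 (fun=> c) x = 0.
Proof. by rewrite /D1 big1// => l _; rewrite subrr scaler0 omul0r. Qed.

Lemma D1_sum (I : Type) (s : seq I) (F : I -> pt -> oct R) x :
  D1 (fun y => \sum_(i <- s) F i y) x = \sum_(i <- s) D1 (F i) x.
Proof.
rewrite /D1 exchange_big; apply: eq_bigr => l _ /=.
by rewrite -omul_sumr -scaler_sumr sumrB.
Qed.

Definition vanishing_oct f : Prop := forall k, vanishing (fun y => f y ord0 k).

(* The conjugate operator applied to D1 gives the sum of the second central
   differences of step 2, which act componentwise. *)
Lemma liouville f : vanishing_oct f -> (forall x, D1 f x = 0) -> forall x, f x = 0.
Proof.
move=> vf Df x; apply/rowP => k; rewrite mxE.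
apply: (@vanishing_harmonic (fun y => f y ord0 k)) => // {}x.
(* The mixed difference, with the one factor 1/2 contained in [D1]; the outer difference along [m]
   is left unnormalised. *)
pose w l m := 2^-1 *: ((f (x + ept m + ept l) - f (x + ept m - ept l)) -
                       (f (x - ept m + ept l) - f (x - ept m - ept l))).
have ws l m : w l m = w m l.
  rewrite /w; congr (_ *: _).
  rewrite [x + ept l + ept m]addrAC [x + ept l - ept m]addrAC.
  rewrite [x - ept l + ept m]addrAC [x - ept l - ept m]addrAC.
  rewrite !opprB !addrA.
  by rewrite [LHS]addrAC [RHS]addrAC [in RHS](addrAC (f (x + ept m + ept l))).
have := clifford_sum_l ws; rewrite exchange_big /= big1 => [|m _]; last first.
  rewrite -scaler_sumr -omul_sumr.
  have -> : \sum_(l < 8) omul (obas R l) (w l m) = D1 f (x + ept m) - D1 f (x - ept m).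
    rewrite /D1 -sumrB; apply: eq_bigr => l _.
    by rewrite -omulBr -scalerBr.
  by rewrite !Df subrr omul0r scaler0.
move/(congr1 (fun a : oct R => 2 * a ord0 k)); rewrite mxE mulr0 summxE mulr_sumr => wE.
rewrite [RHS]wE.
apply: eq_bigr => l _.
have e1 : x + ept l + ept l = x + ept l *+ 2 by rewrite -addrA.
have e2 : x - ept l - ept l = x - ept l *+ 2 by rewrite -addrA -opprD.
rewrite /w addrK subrK e1 e2 octZE mulrA divff// mul1r !mxE; ring.
Qed.

End lattice.

(** * The boundary integral as a potential *)

Section cauchy.
Variable R : realType.
Implicit Types (h : R) (x y z : pt) (f g K : pt -> oct R) (B : set pt).

Lemma E1_expand z : E1 R z = \sum_(m < 8) gradE R m z *: (sgn R m *: obas R m).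
Proof.
apply/rowP => k; rewrite E1E summxE (bigD1 k)//= big1 ?addr0.
  rewrite !octZE [obas R k _ _]mxE eqxx mulr1 mulrC; congr (_ * _).
  by rewrite /sgn /osgn; case: ifP => _; rewrite ?rmorphN1.
by move=> m /negbTE mk; rewrite !octZE mxE eq_sym mk !mulr0.
Qed.

(** The discrete Hessian of the Green function. Its symmetry [GC] and its trace [Gdiv] yield both
    fundamental identities. *)
Let G (l m : 'I_8) z : R := 2^-1 * (gradE R m (z + ept l) - gradE R m (z - ept l)).

Let GC l m z : G l m z = G m l z.
Proof. by rewrite /G gradE_diffC. Qed.

Let Gdiv z : \sum_(l < 8) G l l z = (z == 0)%:R.
Proof. by rewrite /G -mulr_sumr gradE_div mulrA mulVf// mul1r. Qed.

Lemma dcent_E1 z (l : 'I_8) : 2^-1 *: (E1 R (z + ept l) - E1 R (z - ept l)) =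
  \sum_(m < 8) G l m z *: (sgn R m *: obas R m).
Proof.
rewrite !E1_expand -sumrB scaler_sumr; apply: eq_bigr => m _.
by rewrite -scalerBl [LHS]scalerA.
Qed.

(** The bracketing E (e_l w) is that of the star product and puts the conjugate outermost. *)
Lemma right_fundamental z w :
  \sum_(l < 8) omul (2^-1 *: (E1 R (z + ept l) - E1 R (z - ept l))) (omul (obas R l) w) =
  (z == 0)%:R *: w.
Proof.
transitivity (\sum_(l < 8) \sum_(m < 8) sgn R m *: omul (obas R m) (omul (obas R l) (G l m z *: w))).
  apply: eq_bigr => l _; rewrite dcent_E1 omul_suml; apply: eq_bigr => m _.
  by rewrite !omulZl !omulZr scalerA mulrC -scalerA.
rewrite (clifford_sum_l (w := fun l m => G l m z *: w)); first by rewrite -scaler_suml Gdiv.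
by move=> l m; rewrite GC.
Qed.

(** The bracketing e_l (E c) is that of D applied to a potential and puts the conjugate
    innermost. *)
Lemma left_fundamental x c y :
  D1 (fun y => omul (E1 R (y - x)) c) y = (y == x)%:R *: c.
Proof.
rewrite -[y == x]subr_eq0 /D1; set z := y - x.
transitivity (\sum_(m < 8) \sum_(l < 8) sgn R m *: omul (obas R l) (omul (obas R m) (G m l z *: c))).
  rewrite exchange_big; apply: eq_bigr => l _ /=.
  rewrite -omulBl -omulZl [y + _ - x]addrAC [y - _ - x]addrAC dcent_E1 omul_suml omul_sumr.
  apply: eq_bigr => m _; rewrite GC !omulZl !omulZr scalerA mulrC -scalerA.
  by [].
rewrite (clifford_sum_r (w := fun l m => G l m z *: c)); first by rewrite -scaler_suml Gdiv.
by move=> l m; rewrite GC.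
Qed.

(** The operator W; it reads [g] at the neighbours of points of B, not only on the boundary. *)
Definition potential B g y : oct R :=
  \sum_(x <- fset_set B) omul (E1 R (y - x)) (D1 g x).

Lemma D1_potential B g y : finite_set B ->
  D1 (potential B g) y = chi R B y *: D1 g y.
Proof.
move=> fB; rewrite D1_sum (eq_bigr _ (fun x _ => left_fundamental x (D1 g x) y)).
rewrite /chi indicE -(in_fset_set fB).
have [yB|yB] := boolP (y \in fset_set B).
  rewrite (bigD1_seq y)//= ?fset_uniq// eqxx big1 ?addr0// => x /negbTE.
  by rewrite eq_sym => ->; rewrite scale0r.
rewrite scale0r big_seq big1// => x xB.
have /negbTE -> : y != x by apply: contraNneq yB => ->.
by rewrite scale0r.
Qed.

Lemma gradE_vanishing (m : 'I_8) : vanishing (gradE R m).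
Proof. by move=> e; exact: gradE_finite. Qed.

Lemma potential_vanishing B g : vanishing_oct (potential B g).
Proof.
move=> k.
have -> : (fun y => potential B g y ord0 k) = fun y => \sum_(x <- fset_set B)
    \sum_(i < 8) (((if val i == 0%N then 1 else -1) * \sum_(j < 8) D1 g x ord0 j * mcoef R i j k) *
      gradE R i (y - x)).
  apply/funext => y; rewrite /potential summxE; apply: eq_bigr => x _.
  rewrite mxE; apply: eq_bigr => i _; rewrite E1E mulrAC mulr_sumr.
  by apply: eq_bigr => j _; ring.
apply: vanishing_sum => x; apply: vanishing_sum => i; apply: vanishingZ.
exact: vanishing_shift (gradE_vanishing i).
Qed.

(* A finite set carrying every term of the boundary sum and of its translates. *)
Definition thick B : set pt := [set x | exists y, nbhd x y /\ B y].

Lemma bdry_thick B : bdry B `<=` thick B.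
Proof. by move=> x []. Qed.

Lemma sub_thick B : B `<=` thick B.
Proof. by move=> x Bx; exists x; split => //; left. Qed.

Lemma thickD B x l : B x -> thick B (x + ept l).
Proof. by move=> Bx; exists x; split => //; right; exists l; right; rewrite addrK. Qed.

Lemma thickB B x l : B x -> thick B (x - ept l).
Proof. by move=> Bx; exists x; split => //; right; exists l; left; rewrite subrK. Qed.

Lemma thick_finite B : finite_set B -> finite_set (thick B).
Proof.
move=> fB.
pose U := B `|` \bigcup_(l in [set: 'I_8])
  ((fun x => x + ept l) @` B `|` (fun x => x - ept l) @` B).
apply: (@sub_finite_set _ _ U).
  move=> x [y [[->|[l [->|->]]] By]]; first by left.
  - by right; exists l => //; right; exists (x + ept l) => //; rewrite addrK.
  - by right; exists l => //; left; exists (x - ept l) => //; rewrite subrK.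
rewrite /U finite_setU; split => //; apply: bigcup_finite; first exact: finite_finset.
by move=> l _; rewrite finite_setU; split; exact: finite_image.
Qed.

Lemma chi1 B x : B x -> chi R B x = 1.
Proof. by move=> Bx; rewrite /chi indicE mem_set. Qed.

Lemma chi0 B x : ~ B x -> chi R B x = 0.
Proof. by move=> Bx; rewrite /chi indicE memNset. Qed.

Lemma sum_chi_shift B (A : set pt) a (F : pt -> oct R) : finite_set A ->
  (forall x, B x -> A (x + a)) ->
  \sum_(x \in A) chi R B (x - a) *: F x = \sum_(x \in B) F (x + a).
Proof.
move=> fA BA.
have -> : \sum_(x \in B) F (x + a) = \sum_(x \in (fun x => x + a) @` B) F x.
  by rewrite fsbig_image// => x y _ _ /addIr.
rewrite [RHS](eq_fsbigr (fun x => chi R B (x - a) *: F x)); last first.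
  by move=> _ /set_mem[x Bx <-]; rewrite addrK chi1// scale1r.
apply/esym; apply: fsbig_widen.
  by move=> _ [x Bx <-]; exact: BA.
move=> x [_ h] /=; rewrite chi0 ?scale0r// => Bx.
by apply: h; exists (x - a) => //; rewrite subrK.
Qed.

(** The boundary integrand freed of the step and of the square root. It makes sense at every lattice
    point and vanishes off the boundary, so the range of summation can be enlarged. *)
Definition layer (K : pt -> oct R) B x y (w : oct R) : oct R := \sum_(l < 8) 2^-1 *:
  (((chi R B x - chi R B (x - ept l)) *: omul (K (y - x + ept l)) (omul (obas R l) w)) +
   ((chi R B (x + ept l) - chi R B x) *: omul (K (y - x - ept l)) (omul (obas R l) w))).

Lemma chi_bdry B x : ~ bdry B x -> forall y, nbhd x y -> chi R B y = chi R B x.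
Proof.
move=> nb y xy; have [Bx|Bx] := pselect (B x).
  rewrite !chi1//; apply: contrapT => By; apply: nb; split.
    by exists x; split => //; left.
  by exists y.
rewrite !chi0// => By; apply: nb; split; first by exists y.
by exists x; split => //; left.
Qed.

Lemma layer0 K B x y w : ~ bdry B x -> layer K B x y w = 0.
Proof.
move=> nb; rewrite /layer big1// => l _.
have -> : chi R B (x + ept l) = chi R B x by apply: chi_bdry => //; right; exists l; left.
have -> : chi R B (x - ept l) = chi R B x by apply: chi_bdry => //; right; exists l; right.
by rewrite subrr !scale0r addr0 scaler0.
Qed.

Lemma bdry_Sig_gt0 h B x : 0 < h -> bdry B x -> 0 < Sig h B x.
Proof.
move=> h0 [[y [xy By]] [z [xz Bz]]].
have Sge0 : 0 <= Sig h B x by apply: sumr_ge0 => l _; rewrite addr_ge0// sqr_ge0.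
rewrite lt_neqAle Sge0 andbT eq_sym; apply/eqP => /eqP.
rewrite psumr_eq0 => [/allP S0|l _]; last by rewrite addr_ge0// sqr_ge0.
have hn : h^-1 != 0 by rewrite invr_neq0// gt_eqF.
have chix t : nbhd x t -> chi R B t = chi R B x.
  move=> [->//|[l lt]].
  have := S0 l (mem_index_enum l); rewrite paddr_eq0 ?sqr_ge0// !sqrf_eq0 /dpchi /dmchi.
  rewrite !mulf_eq0 !(negbTE hn) !orbF !subr_eq0 => /andP[/eqP e1 /eqP e2].
  by case: lt => ->.
have := chix y xy; rewrite -(chix z xz) chi1// chi0//.
by move/eqP; rewrite oner_eq0.
Qed.

(** The powers h^8 of the surface element, h^-7 of the kernel and h^-1 of the differences of chi
    cancel, and so does the root of [Sig], which is positive on the boundary. *)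
Lemma sdS_star h B x y w : 0 < h -> bdry B x ->
  sdS h B x *: star h B x y w = layer (E1 R) B x y w.
Proof.
move=> h0 bx; have S0 : 0 < Num.sqrt (Sig h B x) by rewrite sqrtr_gt0 bdry_Sig_gt0.
rewrite /star /layer /Eh; move: (E1 R) => K.
rewrite scalerA scaler_sumr; apply: eq_bigr => l _.
rewrite omulDl !omulZl.
rewrite [ept l - x + y]addrC [y + (ept l - x)]addrCA [ept l + _]addrC.
rewrite [- ept l - x + y]addrC [y + (- ept l - x)]addrCA [- ept l + _]addrC.
rewrite !scalerDr !scalerA /sdS /nminus /nplus /dpchi /dmchi.
move: (Num.sqrt _) S0 => S S0.
by congr (_ *: _ + _ *: _); field; rewrite !gt_eqF.
Qed.

Lemma sum_chi_seq B a (F : pt -> oct R) : finite_set B ->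
  (forall x, B x -> thick B (x + a)) ->
  \sum_(x <- fset_set (thick B)) chi R B (x - a) *: F x = \sum_(x <- fset_set B) F (x + a).
Proof.
move=> fB BA; have fA := thick_finite fB.
by rewrite -!fsbig_finite//; exact: sum_chi_shift.
Qed.

(** Abel summation: the terms in chi(x) difference the kernel, while those in chi at a neighbour are
    recentred, which brings the kernel back to y - x and moves the difference onto [g]. *)
Lemma sum_layer K B g y : finite_set B ->
  \sum_(x \in bdry B) layer K B x y (g x) = \sum_(x <- fset_set B)
   (\sum_(l < 8) omul (2^-1 *: (K (y - x + ept l) - K (y - x - ept l)))
                      (omul (obas R l) (g x)) - omul (K (y - x)) (D1 g x)).
Proof.
move=> fB; have fA := thick_finite fB.
rewrite (fsbig_widen _ _ _ (@bdry_thick B)); last by move=> x [_ nb]; exact: layer0.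
rewrite fsbig_finite// exchange_big /=.
pose Phi z l w := omul (K z) (omul (obas R l) w).
pose z x := y - x.
pose P l x := Phi (y - x + ept l) l (g x); pose M l x := Phi (y - x - ept l) l (g x).
have S1 (F : pt -> oct R) : \sum_(x <- fset_set (thick B)) chi R B x *: F x =
    \sum_(x <- fset_set B) F x.
  have := @sum_chi_seq B 0 F fB; under eq_bigr do rewrite subr0.
  under [in RHS]eq_bigr do rewrite addr0.
  by apply => x Bx; rewrite addr0; exact: sub_thick.
have S2 l (F : pt -> oct R) : \sum_(x <- fset_set (thick B)) chi R B (x - ept l) *: F x =
    \sum_(x <- fset_set B) F (x + ept l).
  by apply: sum_chi_seq => // x; exact: thickD.
have S3 l (F : pt -> oct R) : \sum_(x <- fset_set (thick B)) chi R B (x + ept l) *: F x =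
    \sum_(x <- fset_set B) F (x - ept l).
  rewrite -sum_chi_seq//; last by move=> x; exact: thickB.
  by apply: eq_bigr => x _; rewrite opprK.
transitivity (\sum_(l < 8) \sum_(x <- fset_set B)
    2^-1 *: ((P l x - M l x) - Phi (z x) l (g (x + ept l) - g (x - ept l)))).
  apply: eq_bigr => l _.
  under eq_bigr do rewrite !scalerBl.
  rewrite -!scaler_sumr big_split !sumrB /= !S1 S2 S3 -!sumrB -big_split /=.
  congr (_ *: _); apply: eq_bigr => x _.
  have e1 : y - (x + ept l) + ept l = y - x by rewrite opprD addrA subrK.
  have e2 : y - (x - ept l) - ept l = y - x by rewrite opprB [ept l - x]addrC addrA addrK.
  rewrite e1 e2 /P /M /Phi /z !omulBr opprB addrACA [RHS]addrACA.
  by congr (_ + _); rewrite addrC.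
rewrite exchange_big /=; apply: eq_bigr => x _.
rewrite /D1 omul_sumr -sumrB; apply: eq_bigr => l _.
by rewrite scalerBr -omulBl omulZl /Phi !omulZr.
Qed.

(** By [right_fundamental] the differenced kernel in [sum_layer] is a delta at x = y. *)
Lemma cauchy_pompeiu B g y : finite_set B ->
  \sum_(x \in bdry B) layer (E1 R) B x y (g x) = chi R B y *: g y - potential B g y.
Proof.
move=> fB; rewrite sum_layer// /potential.
have -> : chi R B y *: g y = \sum_(x <- fset_set B) (y - x == 0)%:R *: g x.
  rewrite /chi indicE -(in_fset_set fB).
  have [yB|yB] := boolP (y \in fset_set B).
    rewrite (bigD1_seq y)//= ?fset_uniq// subrr eqxx big1 ?addr0// => x /negbTE.
    by rewrite subr_eq0 eq_sym => ->; rewrite scale0r.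
  rewrite scale0r big_seq big1// => x xB.
  have /negbTE -> : y - x != 0 by rewrite subr_eq0; apply: contraNneq yB => ->.
  by rewrite scale0r.
by rewrite -sumrB; apply: eq_bigr => x _; rewrite right_fundamental.
Qed.

(** The density g(x) - g(y) vanishes at y, which removes the jump term chi_B(y) g(y), and D kills
    the constant g(y). Hence one formula covers boundary points inside and outside B. *)
Lemma Qop_potential h B g y : 0 < h -> finite_set B ->
  Qop h B g y = potential B g y.
Proof.
move=> h0 fB; rewrite /Qop /Sop opprD addrCA subrr addr0 scalerN scalerA mulVf// scale1r.
have -> : \sum_(x \in bdry B) (sdS h B x *: star h B x y (g x - g y)) =
    \sum_(x \in bdry B) layer (E1 R) B x y (g x - g y).
  by apply: eq_fsbigr => x /set_mem bx; exact: sdS_star.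
rewrite (@cauchy_pompeiu B (fun x => g x - g y))// subrr scaler0 sub0r opprK.
rewrite /potential; apply: eq_bigr => x _.
by rewrite (D1B g (fun=> g y)) D1_cst subr0.
Qed.

Lemma Pop_potential h B g y : 0 < h -> finite_set B ->
  Pop h B g y = g y - potential B g y.
Proof.
move=> h0 fB; rewrite -(Qop_potential g y h0 fB) /Pop /Qop.
move: (Sop h B g y) => S; apply/eqP; rewrite eq_sym subr_eq -scalerDr addrACA subrr addr0.
by rewrite -mulr2n -(scaler_nat 2 (g y)) scalerA mulVf// scale1r.
Qed.

(** Immediate on the boundary sum but hidden in the potential form; it lets [f] be traded for a
    solution with the same boundary values. *)
Lemma eq_Qop h B f g y : (forall x, bdry B x -> f x = g x) -> bdry B y ->
  Qop h B f y = Qop h B g y.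
Proof.
move=> fg By; rewrite /Qop /Sop (fg y By).
have -> : \sum_(x \in bdry B) (sdS h B x *: star h B x y (f x - g y)) =
    \sum_(x \in bdry B) (sdS h B x *: star h B x y (g x - g y)).
  by apply: eq_fsbigr => x /set_mem bx; rewrite (fg x bx).
by [].
Qed.

(** * Decay in norm versus componentwise finiteness *)

Lemma ptnorm_coord (h : R) x i : 0 < h -> h * `|x ord0 i|%:~R <= ptnorm h x.
Proof.
move=> h0; rewrite -[leLHS](_ : Num.sqrt ((h * (x ord0 i)%:~R) ^+ 2) = _).
  rewrite /ptnorm ler_sqrt; last by apply: sumr_ge0 => j _; exact: sqr_ge0.
  by rewrite (bigD1 i)//= lerDl; apply: sumr_ge0 => j _; exact: sqr_ge0.
by rewrite sqrtr_sqr normrM gtr0_norm// intr_norm.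
Qed.

Lemma ptnorm_finite (h M : R) : 0 < h -> finite_set [set x | ptnorm h x <= M].
Proof.
move=> h0; pose N := (Num.truncn (M / h)).+1.
pose F (u : {ffun 'I_8 -> 'I_(N + N).+1}) : pt := \row_i ((u i)%:Z - N%:Z).
apply: sub_finite_set (finite_image F (@finite_finset _ [set: {ffun 'I_8 -> 'I_(N + N).+1}])) => x /= xM.
have xN i : `|x ord0 i| <= N%:Z.
  have h1 := le_trans (ptnorm_coord x i h0) xM.
  have : `|x ord0 i|%:~R <= N%:R :> R.
    by rewrite (le_trans _ (ltW (truncnS_gt _)))// ler_pdivlMr// mulrC.
  by rewrite -[N%:R]/(N%:Z%:~R) ler_int.
exists [ffun i => inord (absz (x ord0 i + N%:Z))] => //.
apply/rowP => i; rewrite mxE ffunE inordK.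
  have := xN i; rewrite ler_norml => /andP[h1 h2].
  by rewrite gez0_abs ?addrK//; lia.
have := xN i; rewrite ler_norml => /andP[h1 h2]; lia.
Qed.

Lemma onorm_coord (a : oct R) i : `|a ord0 i| <= onorm a.
Proof.
rewrite -sqrtr_sqr /onorm ler_sqrt; last by apply: sumr_ge0 => j _; exact: sqr_ge0.
by rewrite (bigD1 i)//= lerDl; apply: sumr_ge0 => j _; exact: sqr_ge0.
Qed.

Lemma onorm_le_sum (a : oct R) : onorm a <= \sum_(i < 8) `|a ord0 i|.
Proof.
have s0 : 0 <= \sum_(i < 8) `|a ord0 i| by exact: sumr_ge0.
rewrite -[leRHS]ger0_norm// -sqrtr_sqr /onorm ler_sqrt ?sqr_ge0//.
rewrite expr2 mulr_suml; apply: ler_sum => i _.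
rewrite -real_normK ?num_real// expr2 ler_wpM2l//.
by rewrite (bigD1 i)//= lerDl sumr_ge0.
Qed.

Lemma vanishing_onorm h f : 0 < h -> vanishing_oct f ->
  forall e : R, 0 < e -> exists r : R, forall y, r < ptnorm h y -> onorm (f y) < e.
Proof.
move=> h0 vf e e0.
(* Eight components below e/9 leave the norm at most 8e/9, strictly below [e]. *)
have fS : finite_set (\bigcup_(k in [set: 'I_8]) [set y | e / 9 <= `|f y ord0 k|]).
  apply: bigcup_finite; first exact: finite_finset.
  by move=> k _; apply: vf; rewrite divr_gt0.
set S := \bigcup_(k in _) _ in fS.
(* The sum of the norms over the finite exceptional set dominates each of them. *)
exists (\sum_(x <- fset_set S) ptnorm h x) => y yr.
have nS : ~ S y.
  move=> Sy; move: yr; apply/negP; rewrite -leNgt.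
  have yS : y \in fset_set S by rewrite in_fset_set//; exact: mem_set.
  rewrite (bigD1_seq y yS (fset_uniq _)) /= lerDl.
  by apply: sumr_ge0 => x _; exact: sqrtr_ge0.
apply: le_lt_trans (onorm_le_sum _) _.
apply: (@le_lt_trans _ _ (\sum_(i < 8) e / 9)).
  apply: ler_sum => k _; rewrite leNgt; apply/negP => hk; apply: nS.
  by exists k => //=; exact: ltW.
by rewrite sumr_const card_ord -mulr_natl; lra.
Qed.

(** Points of B not covered by the hypothesis only add a finite set. *)
Lemma onorm_vanishing h B f : 0 < h -> finite_set B ->
  (forall e : R, 0 < e -> exists r : R, forall y, clos (~` B) y ->
     r < ptnorm h y -> onorm (f y) < e) ->
  vanishing_oct f.
Proof.
move=> h0 fB hf k e e0; have [r hr] := hf e e0.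
apply: sub_finite_set (_ : _ `<=` B `|` [set y | ptnorm h y <= r]) _.
  move=> y /= ey; have [By|By] := pselect (B y); first by left.
  right; rewrite leNgt; apply/negP => /hr -/(_ (or_introl By)).
  by apply/negP; rewrite -leNgt (le_trans ey)// onorm_coord.
by rewrite finite_setU; split => //; exact: ptnorm_finite.
Qed.

End cauchy.

Theorem mainTheorem13 (R : realType) (h : R) (B : set pt) (f : pt -> oct R) :
  0 < h ->
  (exists M : R, forall y, B y -> ptnorm h y <= M) ->
  ((exists u : pt -> oct R,
      (forall y, B y -> Dh h u y = 0) /\ (forall y, bdry B y -> u y = f y))
   <-> (forall y, bdry B y -> Pop h B f y = f y))
  /\
  ((exists v : pt -> oct R,
      (forall y, ~ B y -> Dh h v y = 0) /\
      (forall e : R, 0 < e -> exists r : R, forall y, clos (~` B) y ->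
          r < ptnorm h y -> onorm (v y) < e) /\
      (forall y, bdry B y -> v y = f y))
   <-> (forall y, bdry B y -> Qop h B f y = f y)).
Proof.
move=> h0 [M BM].
have fB : finite_set B by exact: sub_finite_set BM (ptnorm_finite M h0).
have Dh0 g y : Dh h g y = 0 <-> D1 g y = 0.
  rewrite DhE; split=> [/eqP|->]; last by rewrite scaler0.
  by rewrite scaler_eq0 invr_eq0 gt_eqF//= => /eqP.
split; split.
- move=> [u [Du uf]] y By.
  rewrite Pop_potential// -(Qop_potential f y h0 fB) -(eq_Qop h uf By) Qop_potential//.
  rewrite /potential big_seq big1 ?subr0// => x.
  by rewrite in_fset_set// => /set_mem /Du /Dh0 ->; rewrite omul0r.
(* P f = f says that W f vanishes on the boundary, so subtracting it keeps the boundary values,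
   whatever [f] is elsewhere. *)
- move=> Pf; exists (fun y => f y - potential B f y); split => y By; last first.
    by rewrite -(Pop_potential f y h0 fB) Pf.
  by apply/Dh0; rewrite D1B D1_potential// chi1// scale1r subrr.
- move=> [v [Dv [v0 vf]]] y By.
  rewrite -(eq_Qop h vf By) Qop_potential// -(vf y By); apply/esym/eqP; rewrite -subr_eq0; apply/eqP.
  (* The values of [v] inside B are arbitrary: there D (W v) = D v compensates for them, while
     outside B both D v and D (W v) vanish. *)
  apply: (@liouville _ (fun y => v y - potential B v y)).
    move=> k; have := vanishingD (onorm_vanishing h0 fB v0 k)
      (vanishingZ (-1) (potential_vanishing B v k)).
    by congr vanishing; apply/funext => z; rewrite mulN1r !mxE.
  move=> x; rewrite D1B D1_potential//.
  have [Bx|Bx] := pselect (B x); first by rewrite chi1// scale1r subrr.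
  by rewrite chi0// scale0r subr0; apply/Dh0; exact: Dv.
- move=> Qf; exists (potential B f); split=> [y By|].
    by apply/Dh0; rewrite D1_potential// chi0// scale0r.
  split=> [e e0|y By]; last by rewrite -(Qop_potential f y h0 fB) Qf.
  have [r hr] := vanishing_onorm h0 (potential_vanishing B f) e0.
  by exists r => y _; exact: hr.
Qed.
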